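(* Let $f\in\mathbb{C}[x_1,\dots,x_n]$ be a homogeneous polynomial of degree $d$ given as a blackbox (an oracle returning $f(a)$ for any $a\in\mathbb{C}^n$). Then the following randomized algorithm makes $O(n^2d)$ calls to the blackbox and performs $O(n^2d\log^2d\log\log d+n^{\omega+1})$ arithmetic operations: pick $R\in M_n(\mathbb{C})$ with random entries from a finite set, set $h(x)=f(Rx)$, compute the slices $T_{\bar1},T_{\bar2},T_{\bar3}$ of $h$, reject if $T_{\bar1}$ is singular, otherwise compute $T_{\bar1}'=T_{\bar1}^{-1}$ and accept iff $T_{\bar1}'T_{\bar2}$ and $T_{\bar1}'T_{\bar3}$ commute and $T_{\bar1}'T_{\bar2}$ is diagonalisable over $\mathbb{C}$.
   Context: The model is algebraic: arithmetic operations and equality tests in $\mathbb{C}$ are counted at unit cost. $\omega$ is a feasible exponent of matrix multiplication (two $n\times n$ matrices can be multiplied with $O(n^\omega)$ arithmetic operations). Slices: for a degree-$d$ form $g$ with symmetric tensor $(T_{i_1\dots i_d})$ (the unique symmetric tensor with $g=\sum T_{i_1\dots i_d}x_{i_1}\cdots x_{i_d}$), $T_{\bar k}$ is the $n\times n$ matrix with $(i,j)$ entry $T_{k\dots k\,i\,j}$ ($d-2$ copies of $k$). *)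

(* Defs.v *)
From HB Require Import structures.
From mathcomp Require Import all_boot all_order all_algebra all_fingroup.
From mathcomp Require Import finmap reals complex exp.
From mathcomp Require Import mpoly.

Set Implicit Arguments.
Unset Strict Implicit.
Unset Printing Implicit Defensive.

Import Order.TTheory GRing.Theory Num.Theory.

Local Open Scope ring_scope.

Section SymmetricTensor.
Variables (F : fieldType) (n d : nat).

(* An index (i_1, ..., i_d) is a map 'I_d -> 'I_n. *)
Definition tensor := {ffun {ffun 'I_d -> 'I_n} -> F}.

Definition symmetric_tensor (T : tensor) : Prop :=
  forall (s : 'S_d) (u : {ffun 'I_d -> 'I_n}), T [ffun m => u (s m)] = T u.

Definition tensor_form (T : tensor) : {mpoly F[n]} :=
  \sum_(u : {ffun 'I_d -> 'I_n}) T u *: \prod_(m < d) 'X_(u m).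

Definition symmetric_tensor_of (g : {mpoly F[n]}) (T : tensor) : Prop :=
  symmetric_tensor T /\ g = tensor_form T.

(* The index (k, ..., k, i, j); it has d - 2 copies of k when 2 <= d. *)
Definition slice_index (k i j : 'I_n) : {ffun 'I_d -> 'I_n} :=
  [ffun m : 'I_d =>
     if (m < d - 2)%N then k else if m == (d - 2)%N :> nat then i else j].

Definition slice (T : tensor) (k : 'I_n) : 'M[F]_n :=
  \matrix_(i, j) T (slice_index k i j).

End SymmetricTensor.

Definition lin_subst (F : fieldType) (n : nat) (M : 'M[F]_n)
    (f : {mpoly F[n]}) : {mpoly F[n]} :=
  f \mPo [tuple \sum_(j < n) M i j *: 'X_j | i < n].

Section SymmetricTensorTheory.
Variables (F : numFieldType) (n d : nat).
Implicit Types (u v : {ffun 'I_d -> 'I_n}) (g : {mpoly F[n]}).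

Let mon u : 'X_{1..n} := (\sum_(m < d) U_(u m))%MM.

Lemma tensor_form_coef (T : tensor F n d) m :
  (tensor_form T)@_m = \sum_(u | mon u == m) T u.
Proof.
rewrite /tensor_form raddf_sum [RHS]big_mkcond /=.
apply: eq_bigr => u _.
have -> : \prod_(i < d) 'X_(u i) = 'X_[mon u] :> {mpoly F[n]}.
  by rewrite mprodXE.
by rewrite mcoeffZ mcoeffX; case: eqP => _; rewrite ?mulr1 ?mulr0.
Qed.

Lemma mon_count u i : mon u i = count_mem i (fgraph u).
Proof.
rewrite mnm_sumE -sum1_count /= (big_tuple _ _ _ _ (fun=> 1%N)) [RHS]big_mkcond /=.
rewrite (reindex_onto (fun m : 'I_d => cast_ord (esym (card_ord d)) m) (fun k => cast_ord (card_ord d) k)) /=;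
  last by move=> k _; exact: cast_ordK.
apply: eq_big => m; first by rewrite cast_ordKV eqxx.
rewrite mnm1E tnth_fgraph enum_val_ord cast_ordKV => _.
by case: eqP.
Qed.

Lemma mon_perm u v : mon u = mon v -> exists s : 'S_d, v = [ffun m => u (s m)].
Proof.
move=> e.
have /tuple_permP[s es] : perm_eq (fgraph v) (fgraph u).
  by apply/allP => i _ /=; rewrite -!mon_count e.
pose c (m : 'I_d) : 'I_#|'I_d| := cast_ord (esym (card_ord d)) m.
pose c' (m : 'I_#|'I_d|) : 'I_d := cast_ord (card_ord d) m.
have inj : injective (fun m => c' (s (c m))).
  by move=> a b /cast_ord_inj /perm_inj /cast_ord_inj.
exists (perm inj); apply/ffunP => m; rewrite ffunE permE.
have hv : v m = tnth (fgraph v) (c m) by rewrite tnth_fgraph enum_val_ord cast_ordKV.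
have -> : v m = tnth (fgraph u) (s (c m)).
  rewrite hv; have -> : fgraph v = [tuple tnth (fgraph u) (s i) | i < #|'I_d|].
    by apply: val_inj.
  by rewrite tnth_mktuple.
by rewrite tnth_fgraph enum_val_ord.
Qed.

Lemma mon_permE u (s : 'S_d) : mon [ffun m => u (s m)] = mon u.
Proof.
rewrite /mon [RHS](reindex_inj (@perm_inj _ s)) /=.
by apply: eq_bigr => m _; rewrite ffunE.
Qed.

Lemma mon_onto (m : 'X_{1..n}) : mdeg m = d -> exists u, mon u = m.
Proof.
move=> hm; pose s := flatten [seq nseq (m i) i | i <- enum 'I_n].
have sz : size s = #|'I_d|.
  rewrite card_ord -hm size_flatten /shape -map_comp sumnE big_map big_enum /= mdegE.
  by apply: eq_bigr => i _ /=; rewrite size_nseq.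
exists (Finfun (tcast sz (in_tuple s))); apply/mnmP => i.
rewrite mon_count FinfunK val_tcast /= count_flatten -map_comp sumnE big_map big_enum /=.
rewrite (bigD1 i) //= count_nseq /= eqxx mul1n big1 ?addn0 // => j ji.
by rewrite count_nseq /= (negPf ji) mul0n.
Qed.

Lemma symmetric_tensor_of_unique g :
  g \is d.-homog -> exists! T : tensor F n d, symmetric_tensor_of g T.
Proof.
move=> hg; pose N u := #|[pred v | mon v == mon u]|.
have N0 u : (N u)%:R != 0 :> F.
  by rewrite pnatr_eq0 -lt0n; apply/card_gt0P; exists u; rewrite inE.
exists [ffun u => g@_(mon u) / (N u)%:R]; split.
  split=> [s u|]; first by rewrite !ffunE /N mon_permE.
  apply/mpolyP => m; rewrite tensor_form_coef.
  have [hm|hm] := eqVneq (mdeg m) d; last first.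
    rewrite (dhomog_nemf_coeff hg hm) big_pred0 // => u.
    apply: contraNF hm => /eqP <-.
    by rewrite /mon mdeg_sum (eq_bigr (fun=> 1%N)) ?sum1_card ?card_ord // => i; rewrite mdeg1.
  have [u0 eu] := mon_onto hm.
  rewrite (eq_bigr (fun=> g@_m / (N u0)%:R)); last first.
    by move=> u /eqP e; rewrite ffunE /N eu e.
  rewrite sumr_const [X in _ *+ X](_ : _ = N u0); last by rewrite /N eu.
  by rewrite -[RHS]mulr_natr divfK.
move=> T [sT ->]; apply/ffunP => u; rewrite ffunE tensor_form_coef.
rewrite (eq_bigr (fun=> T u)); last first.
  by move=> v /eqP/esym/mon_perm[s ->]; rewrite sT.
by rewrite sumr_const -[X in X / _]mulr_natr mulfK ?N0.
Qed.
End SymmetricTensorTheory.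

Lemma lin_subst_homog (F : fieldType) (n d : nat) (M : 'M[F]_n)
    (f : {mpoly F[n]}) : f \is d.-homog -> lin_subst M f \is d.-homog.
Proof.
move=> hf; rewrite /lin_subst comp_mpolyE big_seq; apply: rpred_sum => m hm.
apply: rpredZ; rewrite -(dhomog_mf hf hm) /= mdegE.
elim/big_rec2: _ => [|i q k _ IH]; first exact: dhomog1.
apply: dhomogM => //; rewrite -[X in X.-homog]mul1n; apply: dhomogMn.
rewrite tnth_mktuple; apply: rpred_sum => j _; apply: rpredZ.
by rewrite dhomogX /= mdeg1.
Qed.

(* Algebraic computation trees with two extra kinds of nodes: random draws and
   calls to an n-ary blackbox. Each Arith, Draw and Query node appends its
   result to a memory whose cells are never overwritten; cells are addressed by
   their position. Leaves carry a value of type A, typically the addresses of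
   the outputs. *)
Inductive binop := Add | Sub | Mul | Div.

Inductive tree (n : nat) (A : Type) : Type :=
| Halt of A
| Arith of binop & nat & nat & tree n A
| Branch of nat & nat & tree n A & tree n A
| Draw of tree n A
| Query of ('I_n -> nat) & tree n A.

Fixpoint plain (n : nat) (A : Type) (t : tree n A) : bool :=
  match t with
  | Halt _ => true
  | Arith _ _ _ t' => plain t'
  | Branch _ _ t1 t2 => plain t1 && plain t2
  | Draw _ => false
  | Query _ _ => false
  end.

(* ops counts the arithmetic operations and the equality tests. *)
Record outcome (F A : Type) := Outcome {
  answer : A;
  memory : seq F;
  ops : nat;
  calls : nat;
  draws : nat }.

Section Semantics.
Variables (F : fieldType) (n : nat) (A : Type).

Definition eval_binop (o : binop) (x y : F) : option F :=
  match o with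
  | Add => Some (x + y)
  | Sub => Some (x - y)
  | Mul => Some (x * y)
  | Div => if y == 0 then None else Some (x / y)
  end.

Definition count_op (o : outcome F A) :=
  Outcome (answer o) (memory o) (ops o).+1 (calls o) (draws o).
Definition count_call (o : outcome F A) :=
  Outcome (answer o) (memory o) (ops o) (calls o).+1 (draws o).
Definition count_draw (o : outcome F A) :=
  Outcome (answer o) (memory o) (ops o) (calls o) (draws o).+1.

(* r 0, r 1, ... are the successive results of the random draws. The run is
   undefined (None) if it divides by zero. *)
Fixpoint run (f : ('I_n -> F) -> F) (r : nat -> F) (mem : seq F)
    (t : tree n A) : option (outcome F A) :=
  match t with
  | Halt a => Some (Outcome a mem 0 0 0)
  | Arith o i j t' =>
      obind (fun v => omap count_op (run f r (rcons mem v) t'))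
            (eval_binop o mem`_i mem`_j)
  | Branch i j t1 t2 =>
      omap count_op
        (if mem`_i == mem`_j then run f r mem t1 else run f r mem t2)
  | Draw t' =>
      omap count_draw (run f (fun k => r k.+1) (rcons mem (r 0%N)) t')
  | Query a t' =>
      omap count_call (run f r (rcons mem (f (fun i => mem`_(a i)))) t')
  end.

End Semantics.

Definition read_mx (F : fieldType) (n : nat) (mem : seq F)
    (a : 'I_n -> 'I_n -> nat) : 'M[F]_n := \matrix_(i, j) mem`_(a i j).

Definition entries (F : fieldType) (n : nat) (M : 'M[F]_n) : seq F :=
  [seq M i j | i <- enum 'I_n, j <- enum 'I_n].

(* K is the finite list of constants of the algorithm; it does not depend on
   the size n of the matrices. *)
Definition feasible_exponent (R : realType) (w : R) : Prop :=
  exists (K : seq R[i]) (c : R) (P : forall n, tree 0 ('I_n -> 'I_n -> nat)),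
  forall n, (0 < n)%N ->
    plain (P n) /\
    forall A B : 'M[R[i]]_n, exists o : outcome R[i] ('I_n -> 'I_n -> nat),
      [/\ run (fun=> 0) (fun=> 0) (K ++ entries A ++ entries B) (P n) = Some o,
          read_mx (memory o) (answer o) = A *m B
        & (ops o)%:R <= c * n%:R `^ w].

Definition log2 (R : realType) (x : R) : R := ln x / ln 2.

(* slice_at k is the array of addresses of the (k+1)-st slice of h, and inv_at
   the one of the inverse of the first slice (irrelevant if it is singular). *)
Record verdict (n : nat) := Verdict {
  slice_at : 'I_3 -> 'I_n -> 'I_n -> nat;
  inv_at : 'I_n -> 'I_n -> nat;
  accept : bool }.

Definition correct_verdict (F : fieldType) (n : nat) (T : 'I_3 -> 'M[F]_n)
    (mem : seq F) (v : verdict n) : Prop :=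
  let T1 := T (inord 0) in let T2 := T (inord 1) in let T3 := T (inord 2) in
  [/\ forall k, read_mx mem (slice_at v k) = T k,
      T1 \notin unitmx -> accept v = false
    & T1 \in unitmx ->
        read_mx mem (inv_at v) = invmx T1 /\
        (accept v <->
           comm_mx (invmx T1 *m T2) (invmx T1 *m T3) /\
           diagonalizable (invmx T1 *m T2))].

(* The entries of the random matrix are drawn row by row. *)
Definition drawn_mx (F : fieldType) (n : nat) (r : nat -> F) : 'M[F]_n :=
  \matrix_(i, j) r (i * n + j)%N.

(* Main.v *)
Require Import Defs.
From HB Require Import structures.
From mathcomp Require Import all_boot all_order all_algebra all_fingroup.
From mathcomp Require Import finmap reals complex exp.
From mathcomp Require Import mpoly.
From mathcomp Require Import ring lra zify.

Set Implicit Arguments.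
Unset Strict Implicit.
Unset Printing Implicit Defensive.

Import Order.TTheory GRing.Theory Num.Theory.

Local Open Scope ring_scope.

(** The slice of [h(x) = f(Rx)] at [k] is [R^T B R], where [B] is the second-order
    term of [f] at the [k]-th column [p] of [R].  The entries of [B] come from the
    quadratic coefficients of the polynomials [s |-> f(p + s 1_{a,b})], where
    [1_{a,b}] is the indicator vector of two coordinates: the query points only
    use the O(nd) numbers [p_l + s], and each coefficient is a combination of
    O(d) values with explicit weights.  Everything else about the slices is a
    bounded number of naive n x n matrix operations.

    Gauss-Jordan elimination of [[T | 1]] decides the invertibility of [T] and
    inverts it in O(n^3).  For the diagonalisability of [A], the powers of [A] are
    computed with 2n fast multiplications; elimination in the Hankel matrix
    [tr A^(i+j)], stopped at its first dependent column, yields the squarefree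
    part [p] of the characteristic polynomial, and [A] is diagonalisable iff
    [p(A) = 0].

    Since a matrix product can have n^2 new entries, n^2 = O(n^w), so that the
    O(n^3) steps fit in n^(w+1).  For d = 2 the first cost term vanishes and
    this also absorbs the O(n^2 d) steps. *)

(** * Diagonalisability and traces of powers *)

(** Eigenvalues are out of reach of field operations and equality tests, hence a rational criterion
    for diagonalisability. The trace of [A ^+ s] is the sum of the s-th powers of the eigenvalues
    with multiplicities; a multiplicity is nonzero in characteristic 0, so the dependencies between
    the columns of the Hankel matrix see only the set of distinct eigenvalues. The interpolation
    nodes are fixed integers, so that the weights are ratios of factorials and cost O(d) operations
    in all, without fast polynomial arithmetic. Two coordinates at a time suffice by polarisation:
    the values of a symmetric form at 1_{a,a}, 1_{b,b} and 1_{a,b} determine its entry (a,b). No run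
    divides by zero, whatever the draws: the divisors are pivots tested before use, products of
    positive integers and factorials, and d(d-1). The draws serve only as entries of R, so they are
    all made first and the rest is a deterministic program. *)

Lemma trig_mx_mul (F : comNzRingType) n (A B : 'M[F]_n) :
  is_trig_mx A -> is_trig_mx B ->
  is_trig_mx (A *m B) /\ forall i, (A *m B) i i = A i i * B i i.
Proof.
move=> /is_trig_mxP tA /is_trig_mxP tB; split=> [|i].
  apply/is_trig_mxP => i j ij; rewrite mxE big1 // => k _.
  have [ik|ki] := ltnP i k; first by rewrite tA ?mul0r.
  by rewrite tB ?mulr0 // (leq_ltn_trans ki).
rewrite mxE (bigD1 i) //= big1 ?addr0 // => k ki.
have [ik|] := ltnP i k; first by rewrite tA ?mul0r.
by rewrite leq_eqVlt val_eqE (negPf ki) /= => ik; rewrite tB ?mulr0.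
Qed.

Lemma trig_mx_horner (F : comNzRingType) n (A : 'M[F]_n.+1) (g : {poly F}) :
  is_trig_mx A ->
  is_trig_mx (horner_mx A g) /\ forall i, horner_mx A g i i = g.[A i i].
Proof.
move=> tA; elim/poly_ind: g => [|g c [IHt IHd]].
  by rewrite rmorph0; split=> [|i]; [apply/is_trig_mxP => i j _|]; rewrite ?mxE ?horner0.
rewrite rmorphD rmorphM /= horner_mx_X horner_mx_C.
have [tM dM] := trig_mx_mul IHt tA; split=> [|i].
  apply/is_trig_mxP => i j ij; rewrite mxE (is_trig_mxP tM) // mxE add0r.
  by rewrite -val_eqE ltn_eqF.
by rewrite mxE dM IHd !mxE eqxx !hornerE.
Qed.

(** By Schur, [A] is conjugate to a triangular matrix; [ev] lists its diagonal, that is, the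
    eigenvalues with multiplicities, and [g] acts on that diagonal entrywise. *)
Lemma tr_horner_mx_eigen (C : numClosedFieldType) n (A : 'M[C]_n.+1) :
  exists ev : 'I_n.+1 -> C,
    (forall x, root (mxminpoly A) x = (x \in codom ev)) /\
    forall g, \tr (horner_mx A g) = \sum_i g.[ev i].
Proof.
have [P Punitary trigA] := Schur A (ltn0Sn n).
have Pu := unitarymx_unit Punitary.
set T := conjmx P A in trigA; have AT : A = conjmx (invmx P) T by rewrite conjmxK.
exists (fun i => T i i); split=> [x|g].
  rewrite -(mxminpoly_uconj A Pu) root_mxminpoly char_poly_trig // -big_enum.
  rewrite -(big_map _ predT (fun x => 'X - x%:P)).
  by rewrite root_prod_XsubC.
rewrite AT horner_mx_conj ?stablemx_unit ?row_free_unit ?unitmx_inv //.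
rewrite conjVmx // mxtrace_mulC mulmxA mulmxV // mul1mx /mxtrace.
by apply: eq_bigr => i _; rewrite (trig_mx_horner g trigA).2.
Qed.

(* The traces of g(A) A^i see g only through its values at the eigenvalues, so
   the polynomials killed by all those with i <= n are the multiples
   of the squarefree part of the characteristic polynomial. *)
Lemma diagonalizable_trace_kernel (C : numClosedFieldType) n (A : 'M[C]_n.+1)
    (p : {poly C}) :
  p \is monic ->
  (forall i, (i < n.+1)%N -> \tr (horner_mx A (p * 'X^i)) = 0) ->
  (forall q : {poly C}, (size q < size p)%N ->
     (forall i, (i < n.+1)%N -> \tr (horner_mx A (q * 'X^i)) = 0) -> q = 0) ->
  diagonalizable A <-> horner_mx A p = 0.
Proof.
move=> mp kp minp; have [ev [rev trev]] := tr_horner_mx_eigen A.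
have kpoly (g : {poly C}) : (size g <= n.+1)%N -> \tr (horner_mx A (p * g)) = 0.
  move=> sg; rewrite -[g]coefK poly_def mulr_sumr !raddf_sum big1 // => i _.
  rewrite /= -scalerAr linearZ /= linearZ /= kp ?mulr0 //.
  exact: leq_trans (ltn_ord i) sg.
split=> [/diagonalizableP[rs urs dvd]|pA0].
  apply/mxminpoly_minP.
  have [m hm] := dvdp_prod_XsubC dvd; rewrite (eqp_dvdl _ hm).
  apply: uniq_roots_dvdp; last by rewrite uniq_rootsE mask_uniq.
  apply/allP => x xm.
  have : root (mxminpoly A) x by rewrite (eqp_root hm) root_prod_XsubC.
  rewrite rev => /codomP[i ->].
  (* [g] vanishes at all distinct eigenvalues but [ev i], so the trace of (pg)(A) reduces to the
     multiplicity of [ev i] times [p.[ev i] * g.[ev i]]. Its size is the number of distinct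
     eigenvalues, within the range of [kpoly]. *)
  pose s := rem (ev i) (undup (codom ev)).
  pose g := \prod_(z <- s) ('X - z%:P).
  have /kpoly : (size g <= n.+1)%N.
    rewrite size_prod_XsubC size_rem ?mem_undup ?codom_f //.
    rewrite prednK; last by rewrite lt0n size_eq0; apply/eqP => e;
      have := codom_f ev i; rewrite -mem_undup e.
    by rewrite (leq_trans (size_undup _)) // size_codom card_ord.
  have gi : g.[ev i] != 0.
    by rewrite -[_ == 0]/(root g (ev i)) root_prod_XsubC mem_rem_uniqF ?undup_uniq.
  rewrite trev (eq_bigr (fun j => (p.[ev i] * g.[ev i]) *+ (ev j == ev i))).
    rewrite sumrMnr; move/eqP; rewrite mulrn_eq0 mulf_eq0 (negPf gi) orbF.
    by rewrite (bigD1 i) //= eqxx.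
  move=> j _; rewrite hornerM; have [->//|ne] := eqVneq (ev j) (ev i).
  have /rootP-> : root g (ev j); last by rewrite mulr0.
  by rewrite root_prod_XsubC mem_rem_uniq ?undup_uniq // !inE ne mem_undup codom_f.
(* The squarefree polynomial [sf] divides [p] because [p] kills [A]. All the traces attached to [sf]
   vanish, so the minimality of [p] forbids [sf] to be smaller, and the two are associated. *)
pose sf := \prod_(z <- undup (codom ev)) ('X - z%:P).
have sf0 : sf != 0 by rewrite monic_neq0 // monic_prod_XsubC.
have sfp : sf %| p.
  apply: uniq_roots_dvdp; last by rewrite uniq_rootsE undup_uniq.
  apply/allP => x; rewrite mem_undup -rev.
  by move/mxminpoly_minP: pA0 => /dvdpP[q ->] rx; rewrite rootM rx orbT.
have szsf : (size p <= size sf)%N.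
  rewrite leqNgt; apply: contra_neqN sf0 => lt; apply: minp => // i _.
  rewrite trev big1 // => j _; rewrite hornerM.
  have /rootP-> : root sf (ev j); last by rewrite mul0r.
  by rewrite root_prod_XsubC mem_undup codom_f.
apply/diagonalizableP; exists (undup (codom ev)); first exact: undup_uniq.
have : p %= sf.
  rewrite eqp_sym -(dvdp_size_eqp sfp) eqn_leq szsf andbT.
  by rewrite dvdp_leq // monic_neq0.
by rewrite /eqp => /andP[+ _]; apply: dvdp_trans; apply/mxminpoly_minP.
Qed.

(** * The quadratic coefficient of a univariate polynomial *)

Lemma size_poly_diff (F : comNzRingType) (P : {poly F}) N :
  (size P <= N.+1)%N -> (size (P - (P \Po ('X + 1)))%R <= N)%N.
Proof.
move=> sP; rewrite comp_polyE -{1}[P]coefK poly_def -sumrB.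
apply: (leq_trans (size_sum _ _ _)); apply/bigmax_leqP => i _.
rewrite -scalerBr (leq_trans (size_scale_leq _ _)) //.
rewrite exprDn big_ord_recl /= subn0 expr1n.
rewrite mulr1 bin0 mulr1n opprD addNKr size_opp.
apply: (leq_trans (size_sum _ _ _)); apply/bigmax_leqP => j _.
rewrite expr1n mulr1 -scaler_nat (leq_trans (size_scale_leq _ _)) // size_polyXn.
have := leq_trans (ltn_ord i) sP; have := ltn_ord j; rewrite /bump leq0n add1n.
by move: {j}(nat_of_ord j) => j; move: {i}(nat_of_ord i) => i; lia.
Qed.

(** The sum is the [N]-th iterate of [P |-> P - P \Po ('X + 1)] at [x], and each iteration lowers
    the degree. *)
Lemma alternating_bin_sum (F : comNzRingType) N (P : {poly F}) (x : F) :
  (size P <= N)%N ->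
  \sum_(i < N.+1) (-1) ^+ i * 'C(N, i)%:R * P.[x + i%:R] = 0.
Proof.
elim: N P x => [|N IH] P x sP.
  by move: sP; rewrite leqn0 size_poly_eq0 => /eqP->; rewrite big1 // => i _; rewrite horner0 mulr0.
rewrite -[RHS](IH _ x (size_poly_diff sP)).
rewrite big_ord_recl bin0 /= expr0 !mul1r.
(* Pascal's rule splits the sum into one for [P] and one for the shifted polynomial. *)
have -> : \sum_(i < N.+1) (-1) ^+ bump 0 i * 'C(N.+1, bump 0 i)%:R * P.[x + (bump 0 i)%:R]
  = \sum_(i < N.+1) (-1) ^+ i.+1 * 'C(N, i.+1)%:R * P.[x + i.+1%:R]
    + \sum_(i < N.+1) (-1) ^+ i.+1 * 'C(N, i)%:R * P.[x + i.+1%:R].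
  by rewrite -big_split /=; apply: eq_bigr => i _; rewrite binS natrD; ring.
rewrite addrA.
have -> : P.[x + 0%:R] + \sum_(i < N.+1) (-1) ^+ i.+1 * 'C(N, i.+1)%:R * P.[x + i.+1%:R]
  = \sum_(i < N.+1) (-1) ^+ i * 'C(N, i)%:R * P.[x + i%:R].
  rewrite big_ord_recr /= bin_small // mulr0 mul0r addr0.
  by rewrite [RHS]big_ord_recl /= bin0 expr0 !mul1r !addr0.
rewrite -big_split /=; apply: eq_bigr => i _.
rewrite hornerD hornerN horner_comp !hornerE.
have -> : x + i.+1%:R = x + i%:R + 1 by rewrite -natr1 addrA.
by rewrite exprS; ring.
Qed.

(* These are the ratios (-1)^(s+1) C(2m, m+s) / (C(2m, m) s^2): the central
   difference of order 2m of (G - G_0 - G_1 X) / X^2, of degree less than 2m,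
   vanishes, which expresses its value G_2 at 0 through its values at +-s. *)
Definition even_weight (F : fieldType) (m s : nat) : F :=
  (-1) ^+ s.+1 * ((m`! * m`!)%:R / ((s * s)%:R * ((m - s)`! * (m + s)`!)%:R)).

(** The linear term of [G] cancels between s and -s. This is why the 2m+1 nodes -m, ..., m also
    serve for degree 2m+1, and why half of [d], rounded down, is enough later. *)
Lemma even_interpolation (F : numFieldType) m (G : {poly F}) :
  (size G <= m.*2.+2)%N ->
  \sum_(s < m) even_weight F m s.+1
     * (G.[s.+1%:R] + G.[- s.+1%:R] - 2 * G.[0]) = G`_2.
Proof.
move=> sG; pose E := drop_poly 2 G.
have sE : (size E <= m.*2)%N by rewrite size_drop_poly leq_subLR.
have GE x : G.[x] = G`_0 + G`_1 * x + x ^+ 2 * E.[x].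
  rewrite -{1}(poly_take_drop 2 G) hornerD hornerM hornerXn.
  congr (_ + _); last by rewrite mulrC.
  by rewrite horner_poly !big_ord_recr big_ord0 /= expr0 expr1 mulr1 add0r.
have E0 : E.[0] = G`_2 by rewrite horner_coef0 coef_drop_poly.
have fN k : (k`!)%:R != 0 :> F by rewrite pnatr_eq0 -lt0n fact_gt0.
(* Starting at -m with 2m unit steps puts the nodes at -m, ..., m; the sum is then split at the
   central node, whose coefficient [c] is the binomial C(2m, m) up to sign. *)
have := alternating_bin_sum (- m%:R) sE.
have -> : m.*2.+1 = (m + m.+1)%N by rewrite addnS addnn.
rewrite big_split_ord /= big_ord_recl /= addn0 addNr E0.
have wt k : (k <= m.*2)%N -> 'C(m.*2, k)%:R = (m.*2)`!%:R / (k`! * (m.*2 - k)`!)%:R :> F.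
  move=> km; rewrite -(bin_fact km) natrM mulfK //.
  by rewrite natrM mulf_neq0.
set c := (-1) ^+ m * _; move=> H.
have c0 : c != 0.
  by rewrite mulf_neq0 ?signr_eq0 // pnatr_eq0 -lt0n bin_gt0 -addnn leq_addr.
apply: (mulfI c0); rewrite mulr_sumr.
apply/eqP; rewrite -subr_eq0 -oppr_eq0 opprB; apply/eqP.
(* Reversing the lower half pairs the node -(s+1) with s+1; both carry the same binomial and the
   same sign. *)
rewrite -[RHS]H [X in _ = X + _](reindex_inj rev_ord_inj) /= addrCA.
congr (_ + _); rewrite -big_split /= -sumrN; apply: eq_bigr => s _.
rewrite /bump /= add1n.
have sm : (s < m)%N := ltn_ord s.
rewrite !GE expr0n /= !mul0r !mulr0 !addr0.
have -> : - m%:R + (m - s.+1)%:R = - s.+1%:R :> F by rewrite natrB //; ring.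
have -> : - m%:R + (m + s.+1)%:R = s.+1%:R :> F by rewrite natrD; ring.
rewrite /c /even_weight !wt -?addnn ?leq_add2l ?leq_addr //; last first.
  by rewrite (leq_trans (leq_subr _ _)) ?leq_addr.
rewrite addnK subnDl (_ : m + m - (m - s.+1) = m + s.+1)%N; last by lia.
have -> : (-1) ^+ (m - s.+1) = (-1) ^+ (m + s.+1) :> F.
  by rewrite -signr_odd -[RHS]signr_odd oddB // oddD.
rewrite !natrM exprD !exprS.
have s0 : s.+1%:R != 0 :> F by rewrite pnatr_eq0.
move: (fN m) (fN (m - s.+1)%N) (fN (m + s.+1)%N) s0.
move: (m`!%:R) ((m - s.+1)`!%:R) ((m + s.+1)`!%:R) (s.+1%:R) => x y z t x0 y0 z0 t0.
by field; rewrite x0 y0 z0 t0.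
Qed.

(** * Slices as second-order terms *)

Lemma coef2_prod_linear (F : comNzRingType) (I : finType) (a b : I -> F) :
  (\prod_i ((a i)%:P + b i *: 'X))`_2 =
  \sum_(J : {set I} | #|J| == 2) \prod_i (if i \in J then b i else a i).
Proof.
have -> : \prod_i ((a i)%:P + b i *: 'X) = \prod_i (b i *: 'X + (a i)%:P).
  by apply: eq_bigr => i _; rewrite addrC.
rewrite bigA_distr coef_sum [RHS]big_mkcond /=; apply: eq_bigr => J _.
have -> : \prod_i (if i \in J then b i *: 'X else (a i)%:P) =
    (\prod_i (if i \in J then b i else a i)) *: 'X^#|J|.
  rewrite -(prodr_const (mem J)) [X in _ *: X]big_mkcond -scaler_prod.
  by apply: eq_bigr => i _; case: ifP; rewrite ?alg_polyC.
by rewrite coefZ coefXn eq_sym; case: eqP; rewrite ?mulr1 ?mulr0.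
Qed.

(** Two-transitivity of the symmetric group: a symmetric tensor cannot distinguish the pairs of
    slots. *)
Lemma perm_of_pairs (I : finType) (x y x' y' : I) : x != y -> x' != y' ->
  exists s : {perm I}, s x = x' /\ s y = y'.
Proof.
move=> xy xy'; exists (tperm x x' * tperm (tperm x x' y) y')%g.
rewrite !permM tpermL; split; last by rewrite tpermL.
by rewrite tpermD // 1?eq_sym // -{1}(tpermL x x') (inj_eq perm_inj).
Qed.

(** The form restricted to the line p + sv. Writing it through the tensor, one linear factor per
    slot, makes its coefficient of order 2 explicit. *)
Definition line_poly (F : fieldType) (n d : nat) (T : tensor F n d)
    (p v : 'I_n -> F) : {poly F} :=
  \sum_u T u *: \prod_(m < d) ((p (u m))%:P + v (u m) *: 'X).

Section LinePoly.
Variables (F : numFieldType) (n d : nat) (T : tensor F n d).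
Implicit Types (p v : 'I_n -> F).

Lemma horner_line_poly p v s :
  (line_poly T p v).[s] = (tensor_form T).@[fun i => p i + s * v i].
Proof.
rewrite horner_sum /tensor_form raddf_sum /=; apply: eq_bigr => u _.
rewrite hornerZ mevalZ horner_prod rmorph_prod /=; congr (_ * _).
by apply: eq_bigr => m _; rewrite mevalXU !hornerE mulrC.
Qed.

Lemma size_line_poly p v : (size (line_poly T p v) <= d.+1)%N.
Proof.
apply: (leq_trans (size_sum _ _ _)); apply/bigmax_leqP => u _.
apply: (leq_trans (size_scale_leq _ _)).
rewrite -[X in (_ <= X.+1)%N](card_ord d).
apply: (leq_trans (size_prod_leq _ _)).
rewrite leq_subLR addnS ltnS.
rewrite (@leq_trans (\sum_(m < d) 2)) //; last first.
  by rewrite sum_nat_const muln2 -addnn.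
apply: leq_sum => m _; rewrite (leq_trans (size_polyD _ _)) // geq_max.
by rewrite (leq_trans (size_polyC_leq1 _)) // (leq_trans (size_scale_leq _ _)) // size_polyX.
Qed.

End LinePoly.

Section SecondOrder.
Variables (F : numFieldType) (n e : nat).
Notation d := e.+2.
Variable T : tensor F n d.
Hypothesis symT : symmetric_tensor T.
Implicit Types (p v : 'I_n -> F).

Let x : 'I_d := Ordinal (ltnW (ltnSn e.+1)).
Let y : 'I_d := ord_max.

Let xy : x != y. Proof. by rewrite -val_eqE /= ltn_eqF. Qed.

(** The tensor contracted with [p] in all slots but the last two: the Hessian of the form at [p]
    divided by d(d-1). *)
Definition second_order p : 'M[F]_n :=
  \matrix_(i, j) \sum_(u : {ffun 'I_d -> 'I_n} | (u x == i) && (u y == j))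
    T u * \prod_(m < d | (m != x) && (m != y)) p (u m).

Let form (J : {set 'I_d}) p v :=
  \sum_u T u * \prod_m (if m \in J then v (u m) else p (u m)).

(** Each choice of two slots that receive [v] contributes to the coefficient, and by symmetry all
    C(d, 2) choices contribute the value of the last two slots. *)
Lemma coef2_line_poly p v :
  (line_poly T p v)`_2 =
    'C(d, 2)%:R * \sum_i \sum_j second_order p i j * (v i * v j).
Proof.
have -> : (line_poly T p v)`_2 = \sum_(J : {set 'I_d} | #|J| == 2) form J p v.
  rewrite coef_sum exchange_big /=; apply: eq_bigr => u _.
  by rewrite coefZ coef2_prod_linear mulr_sumr.
have formE (J : {set 'I_d}) : #|J| == 2 -> form J p v = form [set x; y] p v.
  move=> /cards2P[x' [y' [xy' ->]]].
  have [s [sx sy]] := perm_of_pairs xy xy'.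
  have inj : injective (fun u : {ffun 'I_d -> 'I_n} => [ffun m => u (s m)]).
    move=> u w /ffunP uw; apply/ffunP => m; have := uw (s^-1 m)%g.
    by rewrite !ffunE permKV.
  rewrite /form [RHS](reindex_inj inj) /=; apply: eq_bigr => u _.
  rewrite symT; congr (_ * _); rewrite (reindex_inj (@perm_inj _ s)) /=.
  by apply: eq_bigr => m _; rewrite !ffunE !inE -sx -sy !(inj_eq perm_inj).
rewrite (eq_bigr _ formE) sumr_const -[LHS]mulr_natl; congr (_%:R * _).
  by rewrite -[in RHS](card_ord d) -card_draws; apply: eq_card => J; rewrite !inE.
rewrite pair_big /= /form (partition_big (fun u : {ffun 'I_d -> 'I_n} => (u x, u y)) predT) //=.
apply: eq_bigr => -[i j] _; rewrite mxE mulr_suml /=.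
apply: eq_big => [u|u /eqP[ui uj]]; first by rewrite xpair_eqE.
rewrite (bigD1 x) //= (bigD1 y) ?(eq_sym y) //= !inE !eqxx orbT ui uj.
rewrite -[RHS]mulrA; congr (_ * _); rewrite [RHS]mulrC -[RHS]mulrA.
congr (_ * (_ * _)); apply: eq_bigr => m /andP[mx my].
by rewrite !inE (negPf mx) (negPf my).
Qed.

Lemma second_order_sym p i j : second_order p i j = second_order p j i.
Proof.
rewrite !mxE.
have inj : injective (fun u : {ffun 'I_d -> 'I_n} => [ffun m => u (tperm x y m)]).
  move=> u w /ffunP uw; apply/ffunP => m; have := uw (tperm x y m).
  by rewrite !ffunE tpermK.
rewrite [RHS](reindex_inj inj) /=; apply: eq_big => [u|u _].
  by rewrite !ffunE tpermL tpermR andbC.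
rewrite symT; congr (_ * _); rewrite [RHS](reindex_inj (@perm_inj _ (tperm x y))) /=.
apply: eq_big => m; last by rewrite ffunE tpermK.
rewrite -(inj_eq (@perm_inj _ (tperm x y)) m x) -(inj_eq (@perm_inj _ (tperm x y)) m y).
by rewrite tpermL tpermR andbC.
Qed.

(** At a basis vector, the only multi-index that survives the contraction is (k, ..., k, i, j). *)
Lemma second_order_delta k : second_order (fun l => (l == k)%:R) = slice T k.
Proof.
apply/matrixP => i j; rewrite !mxE (bigD1 (slice_index _ k i j)) /=; last first.
  by rewrite !ffunE /= !subSS subn0 ltnn eqxx ltnNge leqnSn /= gtn_eqF // !eqxx.
rewrite big1 ?mulr1 => [|m /andP[mx my]]; last first.
  rewrite ffunE subSS subSS subn0; case: ltnP => [_|em]; first by rewrite eqxx.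
  have := ltn_ord m; rewrite ltnS leq_eqVlt; move: mx my.
  by rewrite -!val_eqE /= => mx /negPf->; rewrite ltnS leqNgt ltn_neqAle eq_sym mx em.
rewrite big1 ?addr0 // => u /andP[/andP[/eqP ui /eqP uj] ne].
have [m mP um] : exists2 m : 'I_d, (m != x) && (m != y) & u m != k.
  apply/exists_inP; apply: contraNT ne => /exists_inPn H.
  apply/eqP/ffunP => m; rewrite ffunE subSS subSS subn0.
  have [mx|mx] := eqVneq m x; first by rewrite mx /= ltnn eqxx ui.
  have [my|my] := eqVneq m y; first by rewrite my /= ltnNge leqnSn gtn_eqF //= uj.
  have /eqP-> : u m == k by apply/negPn/H/andP.
  have := ltn_ord m; rewrite ltnS leq_eqVlt; move: (mx) (my).
  rewrite -!val_eqE /= => mx' /negPf->; rewrite ltnS /= => me.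
  by rewrite ltn_neqAle mx' me.
by rewrite (bigD1 m) //= (negPf um) mul0r mulr0.
Qed.

End SecondOrder.

(** For [a = b] this is the basis vector itself, not its double. Keeping the values in {0, 1} is
    what makes the shifted coordinates reusable for all pairs. *)
Definition pair_indicator (F : nzRingType) (n : nat) (a b i : 'I_n) : F :=
  ((i == a) || (i == b))%:R.

Lemma quadratic_form_diag (F : numFieldType) n (B : 'M[F]_n) a :
  \sum_i \sum_j B i j * (pair_indicator F a a i * pair_indicator F a a j) = B a a.
Proof.
rewrite (bigD1 a) //= [X in _ + X]big1 => [|i ia]; last first.
  by rewrite big1 // => j _; rewrite /pair_indicator (negPf ia) mul0r mulr0.
rewrite (bigD1 a) //= big1 => [|j ja]; last first.
  by rewrite /pair_indicator (negPf ja) !mulr0.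
by rewrite /pair_indicator eqxx !mulr1 !addr0.
Qed.

Lemma quadratic_form_pair (F : numFieldType) n (B : 'M[F]_n) a b :
  (forall i j, B i j = B j i) -> a != b ->
  \sum_i \sum_j B i j * (pair_indicator F a b i * pair_indicator F a b j) =
  B a a + B b b + 2 * B a b.
Proof.
move=> sB ab.
have row i : \sum_j B i j * (pair_indicator F a b i * pair_indicator F a b j) =
    pair_indicator F a b i * (B i a + B i b).
  rewrite (bigD1 a) //= (bigD1 b) 1?eq_sym //= big1 => [|j /andP[ja jb]]; last first.
    by rewrite /pair_indicator (negPf ja) (negPf jb) !mulr0.
  by rewrite /pair_indicator !eqxx orbT !mulr1; ring.
rewrite (eq_bigr _ (fun i _ => row i)).
rewrite (bigD1 a) //= (bigD1 b) 1?eq_sym //= big1 => [|j /andP[ja jb]]; last first.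
  by rewrite /pair_indicator (negPf ja) (negPf jb) !mul0r.
by rewrite /pair_indicator !eqxx orbT /= !mul1r (sB b a); ring.
Qed.

Lemma quadratic_form_inj (F : numFieldType) n (B C : 'M[F]_n) :
  (forall i j, B i j = B j i) -> (forall i j, C i j = C j i) ->
  (forall v : 'I_n -> F, \sum_i \sum_j B i j * (v i * v j) =
                         \sum_i \sum_j C i j * (v i * v j)) -> B = C.
Proof.
move=> sB sC BC.
have D a : B a a = C a a by have := BC (pair_indicator F a a); rewrite !quadratic_form_diag.
apply/matrixP => a b; have [<-//|ab] := eqVneq a b.
have := BC (pair_indicator F a b); rewrite !quadratic_form_pair // !D.
by move=> /addrI /mulfI; apply; rewrite pnatr_eq0.
Qed.

Lemma meval_lin_subst (F : fieldType) n (M : 'M[F]_n) (f : {mpoly F[n]}) v :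
  (lin_subst M f).@[v] = f.@[fun i => \sum_j M i j * v j].
Proof.
rewrite comp_mpoly_meval; apply: meval_eq => i; rewrite tnth_mktuple raddf_sum /=.
by apply: eq_bigr => j _; rewrite mevalZ mevalXU.
Qed.

(** Both sides are symmetric, so it is enough to compare their quadratic forms. The map [M] sends
    the line e_k + sv to the line M e_k + s(Mv), hence the line polynomials of the two forms take
    the same values, and C(d, 2) cancels from their coefficients of order 2. *)
Lemma slice_lin_subst (F : numFieldType) n e (M : 'M[F]_n) (f : {mpoly F[n]})
    (T U : tensor F n e.+2) (k : 'I_n) :
  symmetric_tensor_of f U -> symmetric_tensor_of (lin_subst M f) T ->
  slice T k = M^T *m second_order U (fun l => M l k) *m M.
Proof.
move=> [sU fU] [sT hT]; rewrite -(second_order_delta T k).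
apply: quadratic_form_inj; first exact: second_order_sym.
  move=> i j; set S := M^T *m _ *m _.
  suff E : S = S^T by rewrite {1}E [LHS]mxE.
  rewrite /S !trmx_mul trmxK -mulmxA; congr (_ *m (_ *m _)).
  by apply/matrixP => a b; rewrite [RHS]mxE second_order_sym.
move=> v; have C0 : 'C(e.+2, 2)%:R != 0 :> F by rewrite pnatr_eq0 -lt0n bin_gt0.
apply: (mulfI C0); rewrite -coef2_line_poly //.
pose w i := \sum_j M i j * v j.
transitivity ((line_poly U (fun l => M l k) w)`_2).
  have sz (V : tensor F n e.+2) p u : (size (line_poly V p u) <= (e.+2).*2.+2)%N.
    by rewrite (leq_trans (size_line_poly _ _ _)) // ltnS -addnn; lia.
  have val s : (line_poly T (fun l => (l == k)%:R) v).[s] =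
               (line_poly U (fun l => M l k) w).[s].
    rewrite !horner_line_poly -hT -fU meval_lin_subst; apply: meval_eq => i.
    rewrite (eq_bigr (fun j => M i j * (j == k)%:R + s * (M i j * v j))).
      rewrite big_split -mulr_sumr /= (bigD1 k) //= eqxx mulr1 big1 ?addr0 //.
      by move=> j /negPf->; rewrite mulr0.
    by move=> j _; ring.
  (* Interpolation turns equality of the values into equality of the coefficients of order 2. *)
  rewrite -(even_interpolation (sz T _ _)) -(even_interpolation (sz U _ _)).
  by apply: eq_bigr => s _; rewrite !val.
rewrite coef2_line_poly //; congr (_ * _); move: (second_order U _) => S.
transitivity ((\row_i v i *m (M^T *m S *m M) *m \col_i v i) 0 0).
  have wE : M *m \col_i v i = \col_i w i.
    by apply/matrixP => i j; rewrite !mxE; apply: eq_bigr => l _; rewrite mxE.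
  have wE' : \row_i v i *m M^T = \row_i w i.
    by apply/matrixP => i j; rewrite !mxE; apply: eq_bigr => l _; rewrite !mxE mulrC.
  rewrite !mulmxA wE' -mulmxA wE mxE exchange_big /=; apply: eq_bigr => j _.
  by rewrite !mxE mulr_suml; apply: eq_bigr => i _; rewrite !mxE; ring.
move: (M^T *m S *m M) => {}S; rewrite mxE [RHS]exchange_big /=; apply: eq_bigr => j _.
by rewrite !mxE mulr_suml; apply: eq_bigr => i _; rewrite !mxE; ring.
Qed.

(** * Programs *)

Fixpoint tbind (n : nat) (A B : Type) (t : tree n A) (k : A -> tree n B) :
    tree n B :=
  match t with
  | Halt a => k a
  | Arith o i j t' => Arith o i j (tbind t' k)
  | Branch i j t1 t2 => Branch i j (tbind t1 k) (tbind t2 k)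
  | Draw t' => Draw (tbind t' k)
  | Query a t' => Query a (tbind t' k)
  end.

(* A program receives the current size of the memory, which is the address of
   the next cell, and returns the new size with its result; the addresses and
   the control flow are thus known along each branch of the tree. *)
Definition prog (n : nat) (A : Type) := nat -> tree n (A * nat).

Definition ret (n : nat) (A : Type) (a : A) : prog n A := fun z => Halt n (a, z).
Definition bind (n : nat) (A B : Type) (t : prog n A) (k : A -> prog n B) :
    prog n B := fun z => tbind (t z) (fun x => k x.1 x.2).
Definition arith (n : nat) (o : binop) (i j : nat) : prog n nat :=
  fun z => Arith o i j (Halt n (z, z.+1)).
Definition test (n : nat) (i j : nat) : prog n bool :=
  fun z => Branch i j (Halt n (true, z)) (Halt n (false, z)).
Definition query (n : nat) (a : 'I_n -> nat) : prog n nat :=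
  fun z => Query a (Halt n (z, z.+1)).

Section Combinators.
Variables (n : nat) (A : Type).

Fixpoint map_prog (I : eqType) (a0 : A) (g : I -> prog n A) (s : seq I) :
    prog n (I -> A) :=
  match s with
  | [::] => ret n (fun=> a0)
  | i :: s' => bind (g i) (fun a => bind (map_prog a0 g s') (fun h =>
                 ret n (fun j => if j == i then a else h j)))
  end.

Definition tabulate (I : finType) (a0 : A) (g : I -> prog n A) :
  prog n (I -> A) := map_prog a0 g (enum I).

Fixpoint iter_prog (g : nat -> A -> prog n A) (a : A) (k : nat) : prog n A :=
  if k is k'.+1 then bind (iter_prog g a k') (g k') else ret n a.

End Combinators.

Definition scan_prog (n : nat) (A : Type) (g : nat -> A -> prog n A) (a0 : A)
    (k : nat) : prog n (nat -> A) :=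
  iter_prog (fun i h => bind (g i (h i)) (fun a =>
    ret n (fun j => if j == i.+1 then a else h j))) (fun=> a0) k.

Fixpoint sum_prog (n : nat) (I : Type) (g : I -> prog n nat) (s : seq I)
    (acc : nat) : prog n nat :=
  if s is i :: s' then
    bind (g i) (fun x => bind (arith n Add acc x) (sum_prog g s'))
  else ret n acc.

Fixpoint all_prog (n : nat) (I : Type) (g : I -> prog n bool) (s : seq I) :
    prog n bool :=
  if s is i :: s' then
    bind (g i) (fun b => if b then all_prog g s' else ret n false)
  else ret n true.

Fixpoint find_prog (n : nat) (I : Type) (g : I -> prog n bool) (s : seq I) :
    prog n (option I) :=
  if s is i :: s' then
    bind (g i) (fun b => if b then ret n (Some i) else find_prog g s')
  else ret n None.

(** * Correctness and cost triples for programs *)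

Section Specification.
Variables (F : fieldType) (n : nat) (f : ('I_n -> F) -> F).
Implicit Types (mem : seq F) (q c : nat).

(** A Hoare triple for draw-free programs, with [q] and [c] as upper bounds for operations and
    calls. The program is started at the first free address; the result is chosen before [r], so it
    cannot depend on the random stream. *)
Definition runs (A : Type) (t : prog n A) mem q c (Q : A -> seq F -> Prop) :=
  exists (a : A) (ext : seq F) (q' c' : nat),
    [/\ forall r, run f r mem (t (size mem)) =
          Some (Outcome (a, size (mem ++ ext)) (mem ++ ext) q' c' 0),
        (q' <= q)%N, (c' <= c)%N & Q a (mem ++ ext)].

(** The bound on [x] makes the fact stable: an address past the end reads 0 only until the memory
    grows over it. *)
Definition holds mem (x : nat) (v : F) := (x < size mem)%N /\ mem`_x = v.

Lemma holds_prefix mem mem' x v :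
  prefix mem mem' -> holds mem x v -> holds mem' x v.
Proof.
move=> /prefixP[ext ->] [xs <-]; split; last by rewrite nth_cat xs.
by rewrite size_cat ltn_addr.
Qed.

(** The first run makes no draw, so the continuation sees the same stream [r], unshifted. *)
Lemma run_tbind (A B : Type) (t : tree n A) (k : A -> tree n B) r mem a mem' q c :
  run f r mem t = Some (Outcome a mem' q c 0) ->
  run f r mem (tbind t k) =
    omap (fun o => Outcome (answer o) (memory o) (q + ops o) (c + calls o) (draws o))
      (run f r mem' (k a)).
Proof.
elim: t mem q c => [b|o i j t IH|i j t1 IH1 t2 IH2|t IH|qa t IH] mem q c /=.
- by case=> <- <- <- <-; case: (run _ _ _ _) => // -[].
- case: (eval_binop _ _ _) => //= v; case E: (run _ _ _ _) => [[a1 m1 q1 c1 d1]|] //=.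
  case=> e1 e2 <- <- e5; rewrite e1 e2 e5 in E; rewrite (IH _ _ _ E).
  by case: (run _ _ _ _).
- have H t' (IH : forall mem q c, run f r mem t' = Some (Outcome a mem' q c 0) ->
    run f r mem (tbind t' k) =
    omap (fun o => Outcome (answer o) (memory o) (q + ops o) (c + calls o) (draws o))
      (run f r mem' (k a))) : omap (@count_op _ _) (run f r mem t') = Some (Outcome a mem' q c 0) ->
    omap (@count_op _ _) (run f r mem (tbind t' k)) =
    omap (fun o => Outcome (answer o) (memory o) (q + ops o) (c + calls o) (draws o))
      (run f r mem' (k a)).
    case E: (run _ _ _ _) => [[a1 m1 q1 c1 d1]|] //=.
    case=> e1 e2 <- <- e5; rewrite e1 e2 e5 in E; rewrite (IH _ _ _ E).
    by case: (run _ _ _ _).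
  by case: eqP => _; exact: H.
- by case: (run _ _ _ _) => [[]|].
- case E: (run _ _ _ _) => [[a1 m1 q1 c1 d1]|] //=.
  case=> e1 e2 <- <- e5; rewrite e1 e2 e5 in E; rewrite (IH _ _ _ E).
  by case: (run _ _ _ _).
Qed.

Lemma runs_ret (A : Type) (a : A) mem (Q : A -> seq F -> Prop) :
  Q a mem -> runs (ret n a) mem 0 0 Q.
Proof. by move=> Qa; exists a, [::], 0%N, 0%N; rewrite cats0. Qed.

Lemma runs_bind (A B : Type) (t : prog n A) (k : A -> prog n B) mem q1 c1 q2 c2
    (Q1 : A -> seq F -> Prop) (Q : B -> seq F -> Prop) :
  runs t mem q1 c1 Q1 ->
  (forall a mem', prefix mem mem' -> Q1 a mem' -> runs (k a) mem' q2 c2 Q) ->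
  runs (bind t k) mem (q1 + q2) (c1 + c2) Q.
Proof.
move=> [a [ext [q [c [ht hq hc Qa]]]]] /(_ a (mem ++ ext)) [|//|].
  exact: prefix_prefix.
move=> b [ext' [q' [c' [hk hq' hc' Qb]]]].
exists b, (ext ++ ext'), (q + q')%N, (c + c')%N; rewrite catA; split=> //.
- by move=> r; rewrite /bind (run_tbind _ (ht r)) /= hk.
- exact: leq_add.
- exact: leq_add.
Qed.

Lemma runs_weaken (A : Type) (t : prog n A) mem q c q' c'
    (Q Q' : A -> seq F -> Prop) :
  runs t mem q c Q -> (q <= q')%N -> (c <= c')%N ->
  (forall a mem', prefix mem mem' -> Q a mem' -> Q' a mem') ->
  runs t mem q' c' Q'.
Proof.
move=> [a [ext [q0 [c0 [ht hq hc Qa]]]]] qq cc QQ.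
exists a, ext, q0, c0; split=> //; [exact: leq_trans hq qq|exact: leq_trans hc cc|].
by apply: QQ => //; exact: prefix_prefix.
Qed.

Lemma runs_arith o i j v x y mem :
  holds mem i x -> holds mem j y -> eval_binop o x y = Some v ->
  runs (arith n o i j) mem 1 0 (fun a mem' => holds mem' a v).
Proof.
move=> [_ hi] [_ hj] e; exists (size mem), [:: v], 1%N, 0%N; split=> //.
  by move=> r; rewrite /= hi hj e /= cats1 size_rcons.
by rewrite cats1; split; rewrite ?size_rcons // nth_rcons ltnn eqxx.
Qed.

Lemma runs_test i j x y mem :
  holds mem i x -> holds mem j y ->
  runs (test n i j) mem 1 0 (fun b _ => b = (x == y)).
Proof.
move=> [_ hi] [_ hj]; exists (x == y), [::], 1%N, 0%N; split=> //.
by move=> r; rewrite /= hi hj cats0; case: eqP.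
Qed.

Lemma runs_query a v mem :
  (forall g h, g =1 h -> f g = f h) -> (forall i, holds mem (a i) (v i)) ->
  runs (query a) mem 0 1 (fun x mem' => holds mem' x (f v)).
Proof.
move=> ext_f ha; exists (size mem), [:: f v], 0%N, 1%N; split=> //.
  move=> r /=; rewrite cats1 size_rcons; congr (Some (Outcome _ (rcons _ _) _ _ _)).
  by apply: ext_f => i; case: (ha i).
by rewrite cats1; split; rewrite ?size_rcons // nth_rcons ltnn eqxx.
Qed.

Definition monotone (A : Type) (P : A -> seq F -> Prop) :=
  forall a mem mem', prefix mem mem' -> P a mem -> P a mem'.

Lemma holds_monotone v : monotone (fun x mem => holds mem x v).
Proof. by move=> x mem mem'; exact: holds_prefix. Qed.

Lemma runs_map (A : Type) (I : eqType) a0 (g : I -> prog n A) s mem q c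
    (P : I -> A -> seq F -> Prop) :
  (forall i, monotone (P i)) ->
  (forall i mem', i \in s -> prefix mem mem' -> runs (g i) mem' q c (P i)) ->
  runs (map_prog a0 g s) mem (size s * q) (size s * c)
    (fun h mem' => forall i, i \in s -> P i (h i) mem').
Proof.
move=> mP; elim: s mem => [|i s IH] mem hg /=; first exact: runs_ret.
rewrite !mulSn; apply: runs_bind.
  by apply: hg; rewrite ?mem_head ?prefix_refl.
move=> a mem1 p1 Pa; rewrite -[(size s * q)%N]addn0 -[(size s * c)%N]addn0.
apply: runs_bind.
  apply: IH => j mem2 js p2; apply: hg; first by rewrite inE js orbT.
  exact: prefix_trans p1 p2.
move=> h mem2 p2 Ph; apply: runs_ret => j; rewrite inE.
by case: eqP => [-> _|_ /= /Ph //]; exact: mP Pa.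
Qed.

Lemma runs_tabulate (A : Type) (I : finType) a0 (g : I -> prog n A) mem q c
    (P : I -> A -> seq F -> Prop) :
  (forall i, monotone (P i)) ->
  (forall i mem', prefix mem mem' -> runs (g i) mem' q c (P i)) ->
  runs (tabulate a0 g) mem (#|I| * q) (#|I| * c)
    (fun h mem' => forall i, P i (h i) mem').
Proof.
move=> mP hg; rewrite cardE.
apply: (runs_weaken (runs_map a0 mP (fun i mem' _ => hg i mem'))) => //.
by move=> h mem' _ Ph i; apply: Ph; rewrite mem_enum.
Qed.

Lemma runs_iter (A : Type) (g : nat -> A -> prog n A) a k mem q c
    (P : nat -> A -> seq F -> Prop) :
  (forall i b mem', (i < k)%N -> prefix mem mem' -> P i b mem' ->
     runs (g i b) mem' q c (P i.+1)) ->
  P 0%N a mem -> runs (iter_prog g a k) mem (k * q) (k * c) (P k).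
Proof.
move=> hg P0; elim: k hg => [|k IH] hg /=; first exact: runs_ret.
rewrite !mulSnr; apply: runs_bind.
  by apply: IH => i b mem' ik; apply: hg; exact: leqW.
by move=> b mem' pm; exact: hg.
Qed.

Lemma runs_scan (A : Type) (g : nat -> A -> prog n A) a0 k mem q c
    (P : nat -> A -> seq F -> Prop) :
  (forall i, monotone (P i)) ->
  (forall i b mem', (i < k)%N -> prefix mem mem' -> P i b mem' ->
     runs (g i b) mem' q c (P i.+1)) ->
  P 0%N a0 mem ->
  runs (scan_prog g a0 k) mem (k * q) (k * c)
    (fun h mem' => forall j, (j <= k)%N -> P j (h j) mem').
Proof.
move=> mP hg P0.
apply: (runs_iter (P := fun i h mem' => forall j, (j <= i)%N -> P j (h j) mem')).
  move=> i h mem' ik pm Ph; rewrite -[q]addn0 -[c]addn0; apply: runs_bind.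
    by apply: hg => //; exact: Ph.
  move=> a mem2 p2 Pa; apply: runs_ret => j; rewrite leq_eqVlt ltnS.
  by case: eqP => [->//|_ /= /Ph]; exact: mP.
by move=> j; rewrite leqn0 => /eqP->.
Qed.

Lemma runs_sum (I : Type) (g : I -> prog n nat) s acc mem q c (v : I -> F) v0 :
  holds mem acc v0 ->
  (forall i mem', prefix mem mem' ->
     runs (g i) mem' q c (fun x mem2 => holds mem2 x (v i))) ->
  runs (sum_prog g s acc) mem (size s * q.+1) (size s * c)
    (fun x mem' => holds mem' x (v0 + \sum_(i <- s) v i)).
Proof.
elim: s acc v0 mem => [|i s IH] acc v0 mem hacc hg /=.
  by apply: runs_ret; rewrite big_nil addr0.
rewrite !mulSn addSnnS -add1n; apply: runs_bind; first by apply: hg; exact: prefix_refl.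
move=> x mem1 p1 hx; rewrite -[(size s * c)%N]add0n; apply: runs_bind.
  by apply: (runs_arith (v := v0 + v i) _ hx) => //; exact: holds_prefix hacc.
move=> y mem2 p2 hy; rewrite big_cons addrA; apply: IH => // j mem3 p3.
by apply: hg; apply: prefix_trans p1 (prefix_trans p2 p3).
Qed.

Lemma runs_all (I : Type) (g : I -> prog n bool) s mem q c (b : I -> bool) :
  (forall i mem', prefix mem mem' ->
     runs (g i) mem' q c (fun b' _ => b' = b i)) ->
  runs (all_prog g s) mem (size s * q) (size s * c)
    (fun b' _ => b' = all b s).
Proof.
elim: s mem => [|i s IH] mem hg /=; first exact: runs_ret.
rewrite !mulSn; apply: runs_bind; first by apply: hg; exact: prefix_refl.
move=> b' mem1 p1 ->; case: (b i) => /=.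
  by apply: IH => j mem2 p2; apply: hg; exact: prefix_trans p1 p2.
by apply: runs_weaken; [exact: (runs_ret (Q := fun b' _ => b' = false))|..].
Qed.

Lemma runs_find (I : eqType) (g : I -> prog n bool) s mem q c (b : I -> bool) :
  (forall i mem', prefix mem mem' ->
     runs (g i) mem' q c (fun b' _ => b' = b i)) ->
  runs (find_prog g s) mem (size s * q) (size s * c)
    (fun o _ => if o is Some i then i \in s /\ b i
                else forall i, i \in s -> ~~ b i).
Proof.
elim: s mem => [|i s IH] mem hg /=; first exact: runs_ret.
rewrite !mulSn; apply: runs_bind; first by apply: hg; exact: prefix_refl.
move=> b' mem1 p1 ->; case E: (b i) => /=.
  apply: (runs_weaken (q := 0) (c := 0) (Q := fun o _ => o = Some i)) => //.
    exact: runs_ret.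
  by move=> o mem2 _ ->; rewrite mem_head E.
have hg1 j mem2 : prefix mem1 mem2 -> runs (g j) mem2 q c (fun b' _ => b' = b j).
  by move=> p2; apply: hg; exact: prefix_trans p1 p2.
apply: (runs_weaken (IH _ hg1)) => //.
move=> [j|] mem2 _; first by move=> [js bj]; rewrite inE js orbT.
by move=> H j; rewrite inE => /orP[/eqP->|/H //]; rewrite E.
Qed.

End Specification.

(** * Matrix programs *)

Section Relocation.
Variables (n : nat) (base : nat) (rs : seq nat).

(* An address beyond the memory of the embedded tree stays beyond the memory,
   so that it still reads 0. *)
Definition reloc (i : nat) : nat :=
  if (i < size rs)%N then nth 0%N rs i else (base + (i - size rs))%N.

(** The inputs are not copied: the initial cells of the tree are scattered over the existing memory
    at the addresses [rs], and the cells that it creates are contiguous from [base] on. [cur] is the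
    next free address. *)
Fixpoint embed (A : Type) (t : tree 0 A) (cur : nat) : tree n (A * nat) :=
  match t with
  | Halt a => Halt n (a, cur)
  | Arith o i j t' => Arith o (reloc i) (reloc j) (embed t' cur.+1)
  | Branch i j t1 t2 => Branch (reloc i) (reloc j) (embed t1 cur) (embed t2 cur)
  | Draw t' => embed t' cur
  | Query _ t' => embed t' cur
  end.

End Relocation.

Lemma nth_reloc (F : fieldType) (mem e : seq F) (rs : seq nat) i :
  all (fun x => x < size mem)%N rs ->
  (mem ++ e)`_(reloc (size mem) rs i) = ([seq mem`_x | x <- rs] ++ e)`_i.
Proof.
move=> /allP hrs; rewrite /reloc [RHS]nth_cat size_map; case: ltnP => irs.
  by rewrite nth_cat (hrs _ (mem_nth _ irs)) (nth_map 0%N).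
by rewrite nth_cat ltnNge leq_addr /= addKn.
Qed.

(** The induction is over the cells [e] created so far, a common tail of the small memory and of the
    large one. *)
Lemma run_embed (F : fieldType) n (f : ('I_n -> F) -> F) A (t : tree 0 A)
    (mem e : seq F) rs g r o :
  plain t -> all (fun x => x < size mem)%N rs ->
  run g r ([seq mem`_x | x <- rs] ++ e) t = Some o ->
  exists e', memory o = [seq mem`_x | x <- rs] ++ e' /\
    forall r', run f r' (mem ++ e)
        (embed n (size mem) rs t (size (mem ++ e))) =
      Some (Outcome (answer o, size (mem ++ e')) (mem ++ e') (ops o) 0 0).
Proof.
move=> + hrs; elim: t e o => [a|b i j t IH|i j t1 IH1 t2 IH2|t IH|qa t IH] e o //=.
- by move=> _ [<-]; exists e.
- move=> pt; rewrite !nth_reloc //.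
  case: (eval_binop _ _ _) => //= v; rewrite !rcons_cat.
  case E: (run _ _ _ _) => [o'|] //= -[<-] /=.
  have [e' [me' re']] := IH _ _ pt E; exists e'; split=> // r'.
  have -> : (size (mem ++ e)).+1 = size (mem ++ rcons e v).
    by rewrite !size_cat size_rcons addnS.
  by rewrite re'.
- move=> /andP[pt1 pt2]; rewrite !nth_reloc //; case: eqP => _.
    case E: (run _ _ _ _) => [o'|] //= -[<-] /=.
    by have [e' [me' re']] := IH1 _ _ pt1 E; exists e'; split=> // r'; rewrite re'.
  case E: (run _ _ _ _) => [o'|] //= -[<-] /=.
  by have [e' [me' re']] := IH2 _ _ pt2 E; exists e'; split=> // r'; rewrite re'.
Qed.

(** Every new cell costs an operation; the lower bound on the cost of multiplication rests on
    this. *)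
Lemma plain_run_memory (F : fieldType) A (t : tree 0 A) g r (mem : seq F) o :
  plain t -> run g r mem t = Some o ->
  exists2 e, memory o = mem ++ e & (size e <= ops o)%N.
Proof.
elim: t mem o => [a|b i j t IH|i j t1 IH1 t2 IH2|t IH|qa t IH] mem o //=.
- by move=> _ [<-]; exists [::]; rewrite ?cats0.
- move=> pt; case: (eval_binop _ _ _) => //= v.
  case E: (run _ _ _ _) => [o'|] //= -[<-] /=.
  have [e me se] := IH _ _ pt E; exists (v :: e) => //.
  by rewrite me -cats1 -catA.
- move=> /andP[pt1 pt2]; case: eqP => _; case E: (run _ _ _ _) => [o'|] //= -[<-] /=.
    by have [e me se] := IH1 _ _ pt1 E; exists e => //; exact: leqW.
  by have [e me se] := IH2 _ _ pt2 E; exists e => //; exact: leqW.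
Qed.

Section MatrixPrograms.
Variables (F : fieldType) (n : nat) (f : ('I_n -> F) -> F).
Implicit Types (mem : seq F).

Definition mx_holds m k mem (a : 'I_m -> 'I_k -> nat) (X : 'M[F]_(m, k)) :=
  forall i j, holds mem (a i j) (X i j).

Lemma mx_holds_monotone m k (X : 'M[F]_(m, k)) :
  monotone (fun a mem => mx_holds mem a X).
Proof. by move=> a mem mem' p H i j; exact: holds_prefix (H i j). Qed.

Definition tabulate_mx m k (g : 'I_m -> 'I_k -> prog n nat) :
    prog n ('I_m -> 'I_k -> nat) :=
  bind (tabulate 0%N (fun x : 'I_m * 'I_k => g x.1 x.2))
       (fun h => ret n (fun i j => h (i, j))).

Lemma runs_tabulate_mx m k (g : 'I_m -> 'I_k -> prog n nat) (X : 'M[F]_(m, k))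
    mem q c :
  (forall i j mem', prefix mem mem' ->
     runs f (g i j) mem' q c (fun x mem2 => holds mem2 x (X i j))) ->
  runs f (tabulate_mx g) mem (m * k * q) (m * k * c)
    (fun a mem' => mx_holds mem' a X).
Proof.
move=> hg; rewrite -[(m * k * q)%N]addn0 -[(m * k * c)%N]addn0.
have -> : (m * k)%N = #|{: 'I_m * 'I_k}| by rewrite card_prod !card_ord.
apply: runs_bind.
  apply: (runs_tabulate 0%N (P := fun x a mem' => holds mem' a (X x.1 x.2))).
    by move=> x; exact: holds_monotone.
  by move=> x mem'; exact: hg.
by move=> h mem' _ H; apply: runs_ret => i j; exact: (H (i, j)).
Qed.

Definition mul_prog m k p (a : 'I_m -> 'I_k -> nat) (b : 'I_k -> 'I_p -> nat) :=
  tabulate_mx (fun i j =>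
    sum_prog (fun l => arith n Mul (a i l) (b l j)) (enum 'I_k) 0).

Lemma runs_mul m k p (a : 'I_m -> 'I_k -> nat) (b : 'I_k -> 'I_p -> nat) X Y mem :
  holds mem 0 0 -> mx_holds mem a X -> mx_holds mem b Y ->
  runs f (mul_prog a b) mem (m * p * (k * 2)) 0
    (fun x mem' => mx_holds mem' x (X *m Y)).
Proof.
move=> h0 hX hY; rewrite -[X in runs _ _ _ _ X](muln0 (m * p)).
apply: runs_tabulate_mx => i j mem1 p1.
have hs l mem2 : prefix mem1 mem2 -> runs f (arith n Mul (a i l) (b l j)) mem2 1 0
    (fun x mem3 => holds mem3 x (X i l * Y l j)).
  move=> p2; have p12 := prefix_trans p1 p2.
  exact: (runs_arith f (holds_prefix p12 (hX _ _)) (holds_prefix p12 (hY _ _))).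
apply: (runs_weaken (runs_sum (enum 'I_k) (holds_prefix p1 h0) hs)).
- by rewrite size_enum_ord.
- by rewrite muln0.
- by move=> x mem2 _; rewrite add0r big_enum mxE.
Qed.

Definition eq_mx_prog m k (a b : 'I_m -> 'I_k -> nat) : prog n bool :=
  all_prog (fun x : 'I_m * 'I_k => test n (a x.1 x.2) (b x.1 x.2)) (enum {: 'I_m * 'I_k}).

Lemma runs_eq_mx m k (a b : 'I_m -> 'I_k -> nat) X Y mem :
  mx_holds mem a X -> mx_holds mem b Y ->
  runs f (eq_mx_prog a b) mem (m * k) 0 (fun t _ => t = (X == Y)).
Proof.
move=> hX hY.
have ht (x : 'I_m * 'I_k) mem' : prefix mem mem' ->
    runs f (test n (a x.1 x.2) (b x.1 x.2)) mem' 1 0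
      (fun t _ => t = (X x.1 x.2 == Y x.1 x.2)).
  by move=> p; apply: runs_test; [exact: holds_prefix (hX _ _)|exact: holds_prefix (hY _ _)].
apply: (runs_weaken (runs_all (enum {: 'I_m * 'I_k}) ht)).
- by rewrite muln1 -cardE card_prod !card_ord.
- by rewrite muln0.
move=> t mem' _ ->; apply/allP/eqP => [H|-> //].
by apply/matrixP => i j; apply/eqP; apply: (H (i, j)); rewrite mem_enum.
Qed.

(* An output address of the multiplication tree may lie beyond the memory,
   where it reads 0; it is then replaced by the address of the zero cell. *)
Definition fast_mul_prog (K : seq nat) (P : tree 0 ('I_n -> 'I_n -> nat))
    (a b : 'I_n -> 'I_n -> nat) : prog n ('I_n -> 'I_n -> nat) :=
  let rs := K ++ [seq a i j | i <- enum 'I_n, j <- enum 'I_n]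
              ++ [seq b i j | i <- enum 'I_n, j <- enum 'I_n] in
  fun z => bind (embed n z rs P) (fun c z' => Halt n
    ((fun i j => let x := reloc z rs (c i j) in if (x < z')%N then x else 0%N), z')) z.

Lemma runs_fast_mul (K : seq nat) (KF : seq F) (P : tree 0 ('I_n -> 'I_n -> nat))
    (a b : 'I_n -> 'I_n -> nat) X Y mem q :
  plain P ->
  (forall A B : 'M[F]_n, exists o : outcome F ('I_n -> 'I_n -> nat),
      [/\ run (fun=> 0) (fun=> 0) (KF ++ entries A ++ entries B) P = Some o,
          read_mx (memory o) (answer o) = A *m B & (ops o <= q)%N]) ->
  all (fun x => x < size mem)%N K -> [seq mem`_x | x <- K] = KF ->
  holds mem 0 0 -> mx_holds mem a X -> mx_holds mem b Y ->
  runs f (fast_mul_prog K P a b) mem q 0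
    (fun x mem' => mx_holds mem' x (X *m Y)).
Proof.
move=> pP hP szK valK h0 hX hY; have [o [ro XY qo]] := hP X Y.
set rs := K ++ [seq a i j | i <- enum 'I_n, j <- enum 'I_n]
            ++ [seq b i j | i <- enum 'I_n, j <- enum 'I_n].
have szrs : all (fun x => x < size mem)%N rs.
  rewrite !all_cat szK /=; apply/andP; split; apply/allP => x /allpairsP[[i j] [_ _ ->]].
    by case: (hX i j).
  by case: (hY i j).
have valrs : [seq mem`_x | x <- rs] = KF ++ entries X ++ entries Y.
  rewrite !map_cat valK !map_allpairs; congr (_ ++ _ ++ _);
    apply: eq_allpairs => i j; [by case: (hX i j)|by case: (hY i j)].
rewrite -valrs -[map _ _]cats0 in ro.
have [e [me re]] := run_embed f pP szrs ro.
pose c i j := let x := reloc (size mem) rs (answer o i j) in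
  if (x < size (mem ++ e))%N then x else 0%N.
exists c, e, (ops o), 0%N; split=> //.
  move=> r; have := re r; rewrite cats0 => E.
  by rewrite /fast_mul_prog /bind -/rs (run_tbind _ E) /= addn0.
move=> i j; rewrite /c /=; have /matrixP/(_ i j) := XY; rewrite mxE me => <-.
rewrite -nth_reloc //; case: ltnP => hx; first by split.
by rewrite [X in holds _ _ X]nth_default //; exact: holds_prefix (prefix_prefix _ _) h0.
Qed.

End MatrixPrograms.

(** * Gaussian elimination *)

Section Pivoting.
Variables (F : fieldType) (n k : nat).
Implicit Types (X Y : 'M[F]_(n, n + k)) (j : 'I_n).

(* Row equivalence is only recorded through the right kernel. *)
Definition reduced X0 X (t : nat) :=
  (forall v : 'cV[F]_(n + k), X0 *m v = 0 <-> X *m v = 0) /\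
  forall i (l : 'I_(n + k)), (l < t)%N -> X i l = (i == l :> nat)%:R.

(** A Gauss-Jordan step: rows [i] and [j] are exchanged, and column [j] is cleared above the pivot
    as well as below. *)
Definition pivot_step X j i : 'M[F]_(n, n + k) :=
  let Y r l := X (tperm j i r) l in
  let p l := Y j l / Y j (lshift k j) in
  \matrix_(r, l) if r == j then p l else Y r l - Y r (lshift k j) * p l.

Lemma reduced_pivot_step X0 X j (i : 'I_n) :
  (j <= i)%N -> X i (lshift k j) != 0 ->
  reduced X0 X j -> reduced X0 (pivot_step X j i) j.+1.
Proof.
move=> ji piv [kerX unitX]; split=> [v|r l].
  rewrite kerX; set Z := pivot_step X j i.
  have Zj : (Z *m v) j 0 = (X *m v) i 0 / X i (lshift k j).
    rewrite !mxE mulr_suml; apply: eq_bigr => l _.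
    by rewrite mxE eqxx tpermL mulrAC.
  have Zr r : r != j ->
      (Z *m v) r 0 = (X *m v) (tperm j i r) 0 - X (tperm j i r) (lshift k j) * (Z *m v) j 0.
    move=> rj; rewrite !mxE mulr_sumr -sumrB; apply: eq_bigr => l _.
    by rewrite !mxE (negPf rj) eqxx tpermL; ring.
  split=> /matrixP E0; apply/matrixP => r s; rewrite ord1 [RHS]mxE.
    have Zj0 : (Z *m v) j 0 = 0 by rewrite Zj E0 mxE mul0r.
    by have [->//|rj] := eqVneq r j; rewrite Zr // Zj0 E0 mxE mulr0 subr0.
  have Zj0 : (Z *m v) j 0 = 0 by rewrite E0 mxE.
  have [->|ri] := eqVneq r i.
    apply/eqP; move/eqP: Zj0; rewrite Zj mulf_eq0 invr_eq0 (negPf piv) orbF.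
    by [].
  have rj : tperm j i r != j by rewrite -[X in _ != X](tpermR j i) (inj_eq perm_inj).
  have := Zr _ rj; rewrite tpermK Zj0 mulr0 subr0 => <-.
  by rewrite E0 mxE.
(* Rows from [j] on are zero in the columns before [j], so that using row [i] as pivot row does not
   disturb the unit columns already obtained. *)
have zero (s : 'I_n) (l' : 'I_(n + k)) : (j <= s)%N -> (l' < j)%N -> X s l' = 0.
  by move=> js lj; rewrite unitX // gtn_eqF // (leq_trans lj).
rewrite ltnS leq_eqVlt => /orP[/eqP lj|lj].
  have -> : l = lshift k j by apply: val_inj.
  rewrite mxE tpermL -val_eqE /=; case: eqP => rj; first by rewrite divff.
  by rewrite divff // mulr1 subrr.
rewrite mxE tpermL zero // mul0r mulr0 subr0.
have [->|rj] := eqVneq r j; first by rewrite gtn_eqF.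
have [->|ri] := eqVneq r i.
  by rewrite tpermR zero // gtn_eqF // (leq_trans lj).
by rewrite tpermD ?unitX // eq_sym.
Qed.

Definition stop_column (st : option 'I_n) : nat := if st is Some j then j else n.

(** Stopping at [Some j] means that column [j] has no pivot left and so depends on the preceding
    columns; [None] means that the first [n] columns have become the identity. *)
Definition gauss_result X0 X (st : option 'I_n) :=
  reduced X0 X (stop_column st) /\
  forall j, st = Some j -> forall i : 'I_n, (j <= i)%N -> X i (lshift k j) = 0.

(* The unique monic relation expressing column [l] of a reduced matrix through
   the preceding ones. *)
Definition relation_vec X (l : 'I_(n + k)) : 'cV[F]_(n + k) :=
  \col_s ((s == l)%:R - \sum_(r : 'I_n | (r < l)%N && (r == s :> nat)) X r l).

(** The columns before [l] of the reduced matrix are unit vectors, so the entries of column [l] are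
    the coefficients of its own expansion; equality of the kernels carries the relation back to
    [X0]. *)
Lemma reduced_relation X0 X (l : 'I_(n + k)) :
  reduced X0 X l -> (forall i : 'I_n, (l <= i)%N -> X i l = 0) ->
  X0 *m relation_vec X l = 0.
Proof.
move=> [kerX unitX] Xl; apply/kerX/matrixP => i z; rewrite ord1 !mxE.
under eq_bigr => s _ do rewrite mxE mulrBr.
rewrite sumrB (bigD1 l) //= eqxx mulr1 big1 ?addr0; last first.
  by move=> s /negPf->; rewrite mulr0.
under eq_bigr => s _ do rewrite mulr_sumr big_mkcondr /=.
rewrite exchange_big /=.
rewrite (eq_bigr (fun r => (i == r)%:R * X r l)); last first.
  move=> r rl; rewrite -big_mkcond /= (big_pred1 (lshift k r)); last first.
    by move=> s; rewrite /= -[RHS]val_eqE /= eq_sym.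
  by rewrite unitX.
have [il|il] := ltnP i l; last first.
  rewrite big1 ?subr0 ?Xl // => r rl; have [ir|] := eqVneq i r; last by rewrite mul0r.
  by rewrite -ir ltnNge il in rl.
rewrite (bigD1 i) //= eqxx mul1r big1 ?addr0 ?subrr // => r /andP[_].
by rewrite eq_sym => /negPf->; rewrite mul0r.
Qed.

Lemma reduced_independent X0 X t (v : 'cV[F]_(n + k)) :
  (t <= n)%N -> reduced X0 X t ->
  (forall l : 'I_(n + k), (t <= l)%N -> v l 0 = 0) -> X0 *m v = 0 -> v = 0.
Proof.
move=> tn [kerX unitX] vt /kerX /matrixP Xv.
apply/matrixP => l z; rewrite ord1 [RHS]mxE; have [|lt] := leqP t l; first exact: vt.
have := Xv (Ordinal (leq_trans lt tn)) 0; rewrite mxE [RHS]mxE (bigD1 l) //=.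
rewrite unitX //= eqxx mul1r big1 ?addr0 // => s sl.
have [|st] := leqP t s; first by move/vt->; rewrite mulr0.
by rewrite unitX //= eq_sym val_eqE (negPf sl) mul0r.
Qed.

End Pivoting.

Section GaussInverse.
Variables (F : fieldType) (n : nat) (T : 'M[F]_n) (X : 'M[F]_(n, n + n)).

Lemma gauss_unit : gauss_result (row_mx T 1%:M) X None ->
  T \in unitmx /\ rsubmx X = invmx T.
Proof.
move=> [[kerX unitX] _].
have XE : X = row_mx 1%:M (rsubmx X).
  rewrite -[LHS]hsubmxK; congr row_mx; apply/matrixP => i j.
  by rewrite !mxE unitX //= val_eqE.
have TW : T *m rsubmx X = 1%:M.
  apply/matrixP => i j.
  (* With W the right half of [X], this is the vector (-W e_j, e_j) of the kernel of [1 | W]. It is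
     also in the kernel of [T | 1], which says that T W e_j = e_j. *)
  pose v : 'cV[F]_(n + n) := col_mx (- (rsubmx X *m delta_mx j 0)) (delta_mx j 0).
  have : row_mx T 1%:M *m v = 0.
    by apply/kerX; rewrite XE /v mul_row_col !mul1mx addNr.
  rewrite /v mul_row_col mulmxN mul1mx mulmxA => /eqP; rewrite addrC subr_eq0.
  move=> /eqP/matrixP/(_ i 0).
  by rewrite -colE !mxE eqxx andbT => <-.
have [Tu _] := mulmx1_unit TW.
by split=> //; rewrite -[LHS]mul1mx -(mulVmx Tu) -mulmxA TW mulmx1.
Qed.

(** The relation found at column [j] involves only columns of [T] and has coefficient 1 at [j]: a
    nonzero vector of the kernel of [T]. *)
Lemma gauss_not_unit j : gauss_result (row_mx T 1%:M) X (Some j) ->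
  T \notin unitmx.
Proof.
move=> [red /(_ j erefl) Xj].
have := reduced_relation (l := lshift n j) red Xj.
set v := relation_vec _ _; rewrite -[v]vsubmxK mul_row_col mul1mx.
have -> : dsubmx v = 0.
  apply/matrixP => i z; rewrite !mxE -val_eqE /= gtn_eqF; last first.
    by rewrite (leq_trans (ltn_ord j)) ?leq_addr.
  rewrite big1 ?subr0 // => r /andP[_ /eqP e].
  by have := ltn_ord r; rewrite e ltnNge leq_addr.
rewrite addr0 => Tv; apply/negP => Tu.
have /matrixP/(_ j 0) : usubmx v = 0 by rewrite -[LHS]mul1mx -(mulVmx Tu) -mulmxA Tv mulmx0.
rewrite !mxE eqxx big1 ?subr0 => [/eqP|r /andP[rj /eqP e]]; first by rewrite oner_eq0.
by rewrite /= e ltnn in rj.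
Qed.

End GaussInverse.

Section GaussProgram.
Variables (F : fieldType) (n k : nat) (f : ('I_n -> F) -> F).
Notation addr := ('I_n -> 'I_(n + k) -> nat).

Definition pivot_prog (j i : 'I_n) (a : addr) : prog n addr :=
  let b r l := a (tperm j i r) l in
  bind (tabulate 0%N (fun l => arith n Div (b j l) (b j (lshift k j)))) (fun p =>
  tabulate_mx (fun r l => if r == j then ret n (p l) else
    bind (arith n Mul (b r (lshift k j)) (p l)) (fun x => arith n Defs.Sub (b r l) x))).

Lemma runs_pivot mem j i (a : addr) (X : 'M[F]_(n, n + k)) :
  mx_holds mem a X -> X i (lshift k j) != 0 ->
  runs f (pivot_prog j i a) mem ((n + k) + n * (n + k) * 2) 0
    (fun b mem' => mx_holds mem' b (pivot_step X j i)).
Proof.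
move=> hX piv; rewrite -[X in runs _ _ _ _ X](addn0 0).
apply: (runs_bind (Q1 := fun p mem' => forall l,
   holds mem' (p l) (X i l / X i (lshift k j)))).
  have hp l mem' : prefix mem mem' ->
      runs f (arith n Div (a (tperm j i j) l) (a (tperm j i j) (lshift k j))) mem' 1 0
        (fun x mem2 => holds mem2 x (X i l / X i (lshift k j))).
    rewrite tpermL => p1.
    apply: (runs_arith f (holds_prefix p1 (hX _ _)) (holds_prefix p1 (hX _ _))).
    by rewrite /= (negPf piv).
  have := runs_tabulate 0%N (fun l => @holds_monotone F _) hp.
  by rewrite card_ord muln1 muln0.
move=> p mem1 p1 hp; rewrite -[X in runs _ _ _ _ X](muln0 (n * (n + k))).
apply: runs_tabulate_mx => r l mem2 p2; rewrite mxE.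
have p02 := prefix_trans p1 p2.
case: eqP => _.
  apply: (runs_weaken (q := 0) (c := 0) (Q := fun x mem' => x = p l /\ mem' = mem2)) => //.
    exact: runs_ret.
  by move=> x mem3 _ [-> ->]; rewrite tpermL; exact: holds_prefix (hp l).
rewrite tpermL; apply: (runs_bind (q1 := 1) (q2 := 1) (c1 := 0) (c2 := 0)).
  exact: (runs_arith f (holds_prefix p02 (hX _ _)) (holds_prefix p2 (hp _))).
move=> x mem3 p3 hx.
exact: (runs_arith f (holds_prefix (prefix_trans p02 p3) (hX _ _)) hx).
Qed.

Definition gauss_step (t : nat) (s : option 'I_n * addr) :
    prog n (option 'I_n * addr) :=
  if s.1 is Some _ then ret n s else
  if (insub t : option 'I_n) is Some j then
    bind (find_prog (fun i : 'I_n => bind (test n (s.2 i (lshift k j)) 0) (fun b => ret n (~~ b)))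
            [seq i : 'I_n <- enum 'I_n | (j <= i)%N])
      (fun o => if o is Some i then
         bind (pivot_prog j i s.2) (fun a => ret n (None, a))
       else ret n (Some j, s.2))
  else ret n s.

Definition gauss_prog (a : addr) : prog n (option 'I_n * addr) :=
  iter_prog gauss_step (None, a) n.

Lemma runs_gauss mem (a : addr) (X0 : 'M[F]_(n, n + k)) :
  holds mem 0 0 -> mx_holds mem a X0 ->
  runs f (gauss_prog a) mem (n * (n + ((n + k) + n * (n + k) * 2))) 0
    (fun s mem' => exists2 X, gauss_result X0 X s.1 & mx_holds mem' s.2 X).
Proof.
move=> h0 hX0; rewrite -[X in runs _ _ _ _ X](muln0 n).
(* After a stop the remaining rounds change nothing, so the invariant follows the counter [t] only
   while no column has failed. *)
pose P t (s : option 'I_n * addr) mem' := exists2 X : 'M[F]_(n, n + k),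
  if s.1 is Some _ then gauss_result X0 X s.1 else reduced X0 X t
  & mx_holds mem' s.2 X.
apply: (runs_weaken (Q := P n) _ (leqnn _) (leqnn _)); last first.
  by move=> [[j|] b] mem' _ [X HX hb]; exists X; [exact: HX|exact: hb|split|exact: hb].
apply: runs_iter; last by exists X0.
move=> t [st b] mem1 tn p1 [X HX hb]; rewrite /gauss_step /=; case: st HX hb => [j|] /= HX hb.
  apply: (runs_weaken (q := 0) (c := 0) (Q := fun s mem' => s = (Some j, b) /\ mem' = mem1)) => //.
    exact: runs_ret.
  by move=> _ _ _ [-> ->]; exists X.
rewrite insubT /=; set j := Ordinal tn.
rewrite -[X in runs _ _ _ _ X](addn0 0).
rewrite -[Sub t tn]/j.
have jt : j = t :> nat by [].
pose Q1 (o : option 'I_n) (_ : seq F) := if o is Some i then (j <= i)%N /\ X i (lshift k j) != 0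
     else forall i : 'I_n, (j <= i)%N -> X i (lshift k j) = 0.
apply: (runs_bind (Q1 := Q1)).
  have ht (i : 'I_n) mem2 : prefix mem1 mem2 ->
      runs f (bind (test n (b i (lshift k j)) 0) (fun b' => ret n (~~ b'))) mem2 1 0
        (fun b' _ => b' = (X i (lshift k j) != 0)).
    move=> p2; rewrite -[1%N]addn0 -[X in runs _ _ _ _ X](addn0 0).
    apply: runs_bind.
      exact: (runs_test f (holds_prefix p2 (hb _ _)) (holds_prefix (prefix_trans p1 p2) h0)).
    by move=> b' mem3 _ ->; apply: runs_ret.
  apply: (runs_weaken (runs_find _ ht)).
  - by rewrite muln1 size_filter (leq_trans (count_size _ _)) // size_enum_ord.
  - by rewrite muln0.
  move=> [i|] mem2 _; first by rewrite mem_filter => -[/andP[ji _] piv]; split.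
  move=> H i ji; apply/eqP/negPn/H.
  by rewrite mem_filter ji mem_enum.
move=> [i|] mem2 p2 /= => [[ji piv]|H].
  rewrite -[X in runs _ _ _ X _]addn0 -[X in runs _ _ _ _ X](addn0 0).
  apply: runs_bind; first by apply: (runs_pivot _ piv); exact: mx_holds_monotone hb.
  move=> c mem3 p3 hc; apply: runs_ret; exists (pivot_step X j i) => //=.
  by rewrite -jt; apply: reduced_pivot_step; rewrite // jt.
apply: (runs_weaken (q := 0) (c := 0) (Q := fun s mem' => s = (Some j, b) /\ mem' = mem2)) => //.
  exact: runs_ret.
move=> _ _ _ [-> ->]; exists X => /=; last exact: mx_holds_monotone hb.
by split=> [|j' [<-]]; rewrite ?jt.
Qed.

End GaussProgram.

(** * The diagonalisability test *)

(** Among n+1 columns of height n one is dependent: if the first n are independent, it is the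
    last. *)
Definition stop_index (n : nat) (st : option 'I_n) : 'I_(n + 1) :=
  if st is Some j then lshift 1 j else rshift n ord0.

(** The exponents in the Hankel matrix reach (n-1) + n, hence the traces of the powers below 2n. The
    condition p(A) = 0 is tested by comparing A^t, t being the stop column, with the combination of
    lower powers found by the elimination. *)
Definition diag_prog (n : nat) (K : seq nat) (P : tree 0 ('I_n -> 'I_n -> nat))
    (a : 'I_n -> 'I_n -> nat) : prog n bool :=
  bind (scan_prog (fun _ x => fast_mul_prog K P x a)
          (fun i j => if i == j then 1%N else 0%N) n.*2) (fun pw =>
  bind (map_prog 0%N (fun s => sum_prog (fun i : 'I_n => ret n (pw s i i)) (enum 'I_n) 0)
          (iota 0 n.*2)) (fun tr =>
  bind (gauss_prog (fun (i : 'I_n) (l : 'I_(n + 1)) => tr (i + l)%N)) (fun s =>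
  bind (tabulate_mx (fun i j =>
          sum_prog (fun r : 'I_n => arith n Mul (s.2 r (stop_index s.1)) (pw r i j))
            [seq r : 'I_n <- enum 'I_n | (r < stop_column s.1)%N] 0)) (fun b =>
  eq_mx_prog n b (pw (stop_column s.1)))))).

Definition diag_cost (n mu : nat) : nat :=
  (n.*2 * mu + (n.*2 * n + (n * (n + ((n + 1) + n * (n + 1) * 2))
    + (n * n * (n * 2) + n * n))))%N.

Section HankelTest.
Variables (C : numClosedFieldType) (m : nat).
Notation n := m.+1.
Variable A : 'M[C]_n.

Definition trace_hankel : 'M[C]_(n, n + 1) := \matrix_(i, l) \tr (A ^+ (i + l)).

Lemma stop_indexE (st : option 'I_n) : stop_index st = stop_column st :> nat.
Proof. by case: st => //=; rewrite addn0. Qed.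

(** Read as a list of coefficients, a vector of the right kernel is a polynomial q such that all the
    traces of q(A) A^i with i < n vanish, which is the condition in
    [diagonalizable_trace_kernel]. *)
Lemma trace_hankel_mul (q : {poly C}) (i : 'I_n) : (size q <= n + 1)%N ->
  (trace_hankel *m \col_l q`_l) i 0 = \tr (horner_mx A (q * 'X^i)).
Proof.
move=> sq; rewrite mxE -{2}[q]coefK poly_def mulr_suml !raddf_sum /=.
rewrite (big_ord_widen _ (fun l => \tr (horner_mx A (q`_l *: 'X^l * 'X^i))) sq).
rewrite [RHS]big_mkcond /=; apply: eq_bigr => l _; rewrite !mxE.
case: ltnP => lq; last by rewrite nth_default // mulr0.
rewrite -scalerAl linearZ /= linearZ /= -exprD rmorphXn /= horner_mx_X mulrC.
by rewrite (addnC i l).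
Qed.

(** The relation at the first dependent column gives a monic [p] in that kernel, and the
    independence of the columns before it gives the minimality of [p]. *)
Lemma diagonalizable_hankel X st : gauss_result trace_hankel X st ->
  diagonalizable A <->
  \sum_(r : 'I_n | (r < stop_column st)%N) X r (stop_index st) *: A ^+ r =
  A ^+ stop_column st.
Proof.
move=> [red stop]; set t := stop_column st; set l := stop_index st.
pose p : {poly C} := 'X^t - \sum_(r : 'I_n | (r < t)%N) X r l *: 'X^r.
have tn : (t <= n)%N by rewrite /t; case: st {red stop l p t} => //= j; exact: ltnW.
have szs : (size (\sum_(r : 'I_n | (r < t)%N) X r l *: 'X^r)%R <= t)%N.
  apply: (leq_trans (size_sum _ _ _)); apply/bigmax_leqP => r rt.
  by rewrite (leq_trans (size_scale_leq _ _)) // size_polyXn.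
have szp : size p = t.+1 by rewrite size_polyDl ?size_polyN ?size_polyXn.
have mp : p \is monic.
  by rewrite monicE lead_coefDl ?lead_coefXn ?size_polyN ?size_polyXn.
have pA : horner_mx A p = A ^+ t - \sum_(r : 'I_n | (r < t)%N) X r l *: A ^+ r.
  rewrite rmorphB rmorphXn /= horner_mx_X raddf_sum; congr (_ - _).
  by apply: eq_bigr => r _; rewrite /= linearZ /= rmorphXn /= horner_mx_X.
have vp : relation_vec X l = \col_s p`_s.
  apply/matrixP => s z; rewrite !mxE coefB coefXn coef_sum -val_eqE stop_indexE.
  congr (_ - _); first by rewrite /= stop_indexE.
  rewrite big_mkcondr /=; apply: eq_bigr => r _.
  by rewrite coefZ coefXn eq_sym; case: eqP; rewrite ?mulr1 ?mulr0.
have red' : reduced trace_hankel X l by rewrite /l stop_indexE.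
have ker0 : trace_hankel *m relation_vec X l = 0.
  apply: reduced_relation red' _ => i; rewrite stop_indexE /l.
  case: (st) stop => [j|] /= stop; first exact: stop.
  by rewrite leqNgt ltn_ord.
rewrite (diagonalizable_trace_kernel mp); first last.
- move=> q; rewrite szp ltnS => sq kq; apply/polyP => s; rewrite coef0.
  have [st'|ts] := ltnP s t; last by rewrite nth_default // (leq_trans sq).
  have sn : (s < n + 1)%N by rewrite addn1 ltnS ltnW // (leq_trans st').
  have /matrixP/(_ (Ordinal sn) 0) : \col_(l < n + 1) q`_l = 0 :> 'cV[C]_(n + 1).
    apply: (reduced_independent tn red) => [s' ts'|].
      by rewrite mxE nth_default // (leq_trans sq).
    apply/matrixP => i z; rewrite ord1 trace_hankel_mul ?mxE ?kq //.
    by rewrite (leq_trans sq) // (leq_trans tn) // leq_addr.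
  by rewrite !mxE.
- move=> i ilt; have := trace_hankel_mul (Ordinal ilt) (q := p).
  by rewrite -vp ker0 mxE => <- //; rewrite szp addn1 ltnS.
rewrite pA; split=> [/eqP|->]; last by rewrite subrr.
by rewrite subr_eq0 => /eqP.
Qed.

Variables (f : ('I_n -> C) -> C) (K : seq nat) (KF : seq C).
Variables (P : tree 0 ('I_n -> 'I_n -> nat)) (mu : nat).
Hypothesis plainP : plain P.
Hypothesis mulP : forall X Y : 'M[C]_n,
  exists o : outcome C ('I_n -> 'I_n -> nat),
    [/\ run (fun=> 0) (fun=> 0) (KF ++ entries X ++ entries Y) P = Some o,
        read_mx (memory o) (answer o) = X *m Y & (ops o <= mu)%N].

Lemma runs_diag mem (a : 'I_n -> 'I_n -> nat) :
  all (fun x => x < size mem)%N K -> [seq mem`_x | x <- K] = KF ->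
  holds mem 0 0 -> holds mem 1 1 -> mx_holds mem a A ->
  runs f (diag_prog K P a) mem (diag_cost n mu) 0 (fun b _ => b <-> diagonalizable A).
Proof.
move=> szK valK h0 h1 hA; rewrite /diag_cost -[X in runs _ _ _ _ X](addn0 0).
apply: (runs_bind (Q1 := fun pw mem' => forall s, (s <= n.*2)%N ->
    mx_holds mem' (pw s) (A ^+ s))).
  rewrite -[X in runs _ _ _ _ X](muln0 n.*2).
  apply: (runs_scan (P := fun s x mem' => mx_holds mem' x (A ^+ s))).
  - by move=> s; exact: mx_holds_monotone.
  - move=> s x mem1 _ p1 hx; rewrite exprSr; apply: runs_fast_mul plainP mulP _ _ _ hx _.
    + apply: sub_all szK => y ys; rewrite (leq_trans ys) //.
      by have /prefixP[e ->] := p1; rewrite size_cat leq_addr.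
    + rewrite -valK; apply/eq_in_map => y yK.
      by have /prefixP[e ->] := p1; rewrite nth_cat (allP szK).
    + exact: holds_prefix h0.
    + exact: mx_holds_monotone hA.
  - by move=> i j; rewrite expr0 mxE; case: eqP.
move=> pw mem1 p1 hpw; rewrite -[X in runs _ _ _ _ X](addn0 0).
apply: (runs_bind (Q1 := fun tr mem' => forall s, (s < n.*2)%N ->
    holds mem' (tr s) (\tr (A ^+ s)))).
  have hs s mem2 : s \in iota 0 n.*2 -> prefix mem1 mem2 ->
     runs f (sum_prog (fun i : 'I_n => ret n (pw s i i)) (enum 'I_n) 0) mem2 n 0
       (fun x mem' => holds mem' x (\tr (A ^+ s))).
    rewrite mem_iota => /andP[_ sn] p2.
    have hi (i : 'I_n) mem3 : prefix mem2 mem3 -> runs f (ret n (pw s i i)) mem3 0 0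
       (fun x mem' => holds mem' x ((A ^+ s) i i)).
      move=> p3; apply: runs_ret; apply: holds_prefix (prefix_trans p2 p3) _.
      by apply: hpw; exact: ltnW.
    apply: (runs_weaken (runs_sum (enum 'I_n) (holds_prefix (prefix_trans p1 p2) h0) hi)).
    - by rewrite size_enum_ord muln1.
    - by rewrite muln0.
    - by move=> x mem3 _; rewrite add0r big_enum.
  apply: (runs_weaken (runs_map 0%N (fun s => @holds_monotone C _) hs)).
  - by rewrite size_iota.
  - by rewrite muln0.
  - by move=> tr mem2 _ H s sn; apply: H; rewrite mem_iota.
move=> tr mem2 p2 htr; rewrite -[X in runs _ _ _ _ X](addn0 0).
apply: runs_bind.
  apply: (runs_gauss f (X0 := trace_hankel) (holds_prefix (prefix_trans p1 p2) h0)).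
  move=> i l; rewrite mxE; apply: htr.
  have := ltn_ord i; have := ltn_ord l; rewrite -addnn.
  by move: (nat_of_ord i) (nat_of_ord l) => i' l'; lia.
move=> [st x] mem3 p3 /= [X res hx]; rewrite -[X in runs _ _ _ _ X](addn0 0).
have tn : (stop_column st <= n)%N by case: (st) => //= j; exact: ltnW.
have t2n s : (s <= n)%N -> (s <= n.*2)%N by move/leq_trans; apply; rewrite -addnn leq_addr.
have p23 := prefix_trans p2 p3.
pose S := \sum_(r : 'I_n | (r < stop_column st)%N) X r (stop_index st) *: A ^+ r.
apply: (runs_bind (Q1 := fun b mem' => mx_holds mem' b S)).
  rewrite -[X in runs _ _ _ _ X](muln0 (n * n)); apply: runs_tabulate_mx => i j mem4 p4.
  have hr (r : 'I_n) mem5 : prefix mem4 mem5 ->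
      runs f (arith n Mul (x r (stop_index st)) (pw r i j)) mem5 1 0
        (fun y mem' => holds mem' y (X r (stop_index st) * (A ^+ r) i j)).
    move=> p5; have p45 := prefix_trans p4 p5.
    apply: (runs_arith f (holds_prefix p45 (hx _ _))
                         (holds_prefix (prefix_trans p23 p45) (hpw _ _ _ _))) => //.
    by apply: t2n; exact: ltnW.
  have h04 := holds_prefix (prefix_trans p1 (prefix_trans p23 p4)) h0.
  apply: (runs_weaken (runs_sum _ h04 hr)).
  - by rewrite leq_mul2r size_filter (leq_trans (count_size _ _)) ?size_enum_ord.
  - by rewrite muln0.
  move=> y mem5 _; rewrite add0r big_filter big_enum_cond summxE.
  by under [X in _ -> holds _ _ X]eq_bigr do rewrite mxE.
move=> b mem4 p4 hb.
have hpt := mx_holds_monotone (prefix_trans p23 p4) (hpw _ (t2n _ tn)).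
apply: (runs_weaken (runs_eq_mx f hb hpt)) => //.
move=> b' mem5 _ ->; rewrite (diagonalizable_hankel res).
by split=> /eqP.
Qed.

End HankelTest.

(** * The slices *)

Lemma leq_double_half k : (k <= k./2.*2.+1)%N.
Proof. by rewrite -{1}[k]odd_double_half -[_.+1]add1n leq_add2r; case: odd. Qed.

Section SlicePrograms.
Variables (F : numFieldType) (n d : nat).

Definition num_prog : prog n (nat -> nat) :=
  scan_prog (fun _ x => arith n Add x 1) 0%N d.

Definition fact_prog (num : nat -> nat) : prog n (nat -> nat) :=
  scan_prog (fun i x => arith n Mul x (num i.+1)) 1%N d.

(** The parity of [s] is known when the tree is built, so the sign requires no test, only a
    subtraction from the zero cell. *)
Definition weight_prog (num fct : nat -> nat) (m s : nat) : prog n nat :=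
  bind (arith n Mul (fct m) (fct m)) (fun x =>
  bind (arith n Mul (num s) (num s)) (fun y =>
  bind (arith n Mul (fct (m - s)%N) (fct (m + s)%N)) (fun z =>
  bind (arith n Mul y z) (fun u =>
  bind (arith n Div x u) (fun v =>
  if odd s then ret n v else arith n Defs.Sub 0 v))))).

Definition point_prog (o : binop) (num : nat -> nat) (pa : 'I_n -> nat) (m : nat) :
    prog n (nat -> 'I_n -> nat) :=
  map_prog (fun=> 0%N) (fun s => tabulate 0%N (fun l => arith n o (pa l) (num s.+1)))
    (iota 0 m).

(** The query point is assembled from addresses, without any operation. *)
Definition shift_pair (a b : 'I_n) (pa pa' : 'I_n -> nat) (l : 'I_n) : nat :=
  if (l == a) || (l == b) then pa' l else pa l.

Definition coef2_prog (wt : nat -> nat) (pa : 'I_n -> nat)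
    (plus minus : nat -> 'I_n -> nat) (m : nat) (a b : 'I_n) : prog n nat :=
  bind (query pa) (fun g0 =>
  sum_prog (fun s : 'I_m =>
    bind (query (shift_pair a b pa (plus s))) (fun gp =>
    bind (query (shift_pair a b pa (minus s))) (fun gm =>
    bind (arith n Add gp gm) (fun x =>
    bind (arith n Defs.Sub x g0) (fun y =>
    bind (arith n Defs.Sub y g0) (fun z => arith n Mul (wt s) z))))))
    (enum 'I_m) 0).

(** Polarisation: the entries of [q] carry the factor C(d, 2), so the result is d(d-1) = 2 C(d, 2)
    times the second-order matrix. The division is postponed to the end of [slice_prog]. *)
Definition hessian_prog (q : 'I_n -> 'I_n -> nat) : prog n ('I_n -> 'I_n -> nat) :=
  tabulate_mx (fun a b =>
    if a == b then arith n Add (q a a) (q a a) else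
    bind (arith n Defs.Sub (q a b) (q a a)) (fun x => arith n Defs.Sub x (q b b))).

Definition slice_prog (num wt : nat -> nat) (Ma : 'I_n -> 'I_n -> nat)
    (pa : 'I_n -> nat) : prog n ('I_n -> 'I_n -> nat) :=
  bind (point_prog Add num pa d./2) (fun plus =>
  bind (point_prog Defs.Sub num pa d./2) (fun minus =>
  bind (tabulate_mx (coef2_prog wt pa plus minus d./2)) (fun q =>
  bind (hessian_prog q) (fun H =>
  bind (mul_prog n (fun i j => Ma j i) H) (fun X =>
  bind (mul_prog n X Ma) (fun Y =>
  bind (arith n Mul (num d) (num d.-1)) (fun c =>
  tabulate_mx (fun i j => arith n Div (Y i j) c)))))))).

Definition slice_cost : nat :=
  (d./2 * n + (d./2 * n + (n * n * (d./2 * 5) + (n * n * 2 +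
    (n * n * (n * 2) + (n * n * (n * 2) + (1 + n * n * 1)))))))%N.

Definition setup_prog : prog n ((nat -> nat) * (nat -> nat)) :=
  bind num_prog (fun num =>
  bind (fact_prog num) (fun fct =>
  bind (map_prog 0%N (fun s => weight_prog num fct d./2 s.+1) (iota 0 d./2))
    (fun wt => ret n (num, wt)))).

Variable f : ('I_n -> F) -> F.
Implicit Types (mem : seq F).

Definition setup_done (x : (nat -> nat) * (nat -> nat)) mem :=
  (forall s, (s <= d)%N -> holds mem (x.1 s) s%:R) /\
  (forall s, (s < d./2)%N -> holds mem (x.2 s) (even_weight F d./2 s.+1)).

Lemma runs_weight num fct m s mem :
  (0 < s <= m)%N -> holds mem 0 0 ->
  (forall i, (i <= m.*2)%N -> holds mem (num i) i%:R) ->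
  (forall i, (i <= m.*2)%N -> holds mem (fct i) i`!%:R) ->
  runs f (weight_prog num fct m s) mem 6 0
    (fun x mem' => holds mem' x (even_weight F m s)).
Proof.
move=> /andP[s0 sm] h0 hn hf; have mm : (m <= m.*2)%N by rewrite -addnn leq_addr.
apply: (runs_bind (q1 := 1) (q2 := 5) (c1 := 0) (c2 := 0)).
  by apply: (runs_arith f (hf _ mm) (hf _ mm)).
move=> x mem1 p1 hx; apply: (runs_bind (q1 := 1) (q2 := 4) (c1 := 0) (c2 := 0)).
  have hs := holds_prefix p1 (hn _ (leq_trans sm mm)).
  by apply: (runs_arith f hs hs).
move=> y mem2 p2 hy; apply: (runs_bind (q1 := 1) (q2 := 3) (c1 := 0) (c2 := 0)).
  have i1 : (m - s <= m.*2)%N by rewrite (leq_trans (leq_subr _ _)).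
  have i2 : (m + s <= m.*2)%N by rewrite -addnn leq_add2l.
  exact: (runs_arith f (holds_prefix (prefix_trans p1 p2) (hf _ i1))
                       (holds_prefix (prefix_trans p1 p2) (hf _ i2))).
move=> z mem3 p3 hz; apply: (runs_bind (q1 := 1) (q2 := 2) (c1 := 0) (c2 := 0)).
  exact: (runs_arith f (holds_prefix p3 hy) hz).
move=> u mem4 p4 hu; apply: (runs_bind (q1 := 1) (q2 := 1) (c1 := 0) (c2 := 0)).
  apply: (runs_arith f (holds_prefix (prefix_trans p2 (prefix_trans p3 p4)) hx) hu).
  rewrite /= ifF //; apply/negbTE; rewrite -!natrM pnatr_eq0 !muln_eq0 !negb_or.
  by rewrite -!lt0n s0 !fact_gt0.
move=> v mem5 p5; rewrite -!natrM => hv.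
have sgn : even_weight F m s =
    if odd s then (m`! * m`!)%:R / (s * s * ((m - s)`! * (m + s)`!))%:R
    else 0 - (m`! * m`!)%:R / (s * s * ((m - s)`! * (m + s)`!))%:R.
  rewrite /even_weight -natrM exprS -signr_odd.
  by case: odd; rewrite ?expr1 ?expr0 ?mulrNN ?mul1r // mulr1 mulN1r sub0r.
rewrite sgn; case: odd.
  apply: (runs_weaken (q := 0) (c := 0) (Q := fun x mem' => x = v /\ mem' = mem5)) => //.
    exact: runs_ret.
  by move=> _ _ _ [-> ->].
have p := prefix_trans p1 (prefix_trans p2 (prefix_trans p3 (prefix_trans p4 p5))).
exact: (runs_arith f (holds_prefix p h0) hv).
Qed.

Lemma runs_setup mem : holds mem 0 0 -> holds mem 1 1 ->
  runs f setup_prog mem (d * 1 + (d * 1 + d./2 * 6)) 0 setup_done.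
Proof.
move=> h0 h1; apply: (runs_bind (c1 := 0) (c2 := 0)
  (Q1 := fun num mem' => forall s, (s <= d)%N -> holds mem' (num s) s%:R)).
  rewrite -[X in runs _ _ _ _ X](muln0 d).
  apply: (runs_scan (P := fun s x mem' => holds mem' x s%:R)) => // [s|i x mem1 _ p1 hx].
    exact: holds_monotone.
  apply: (runs_arith f hx (holds_prefix p1 h1)).
  by rewrite /= natr1.
move=> num mem1 p1 hn; apply: (runs_bind (c1 := 0) (c2 := 0)
  (Q1 := fun fct mem' => forall s, (s <= d)%N -> holds mem' (fct s) s`!%:R)).
  rewrite -[X in runs _ _ _ _ X](muln0 d).
  apply: (runs_scan (P := fun s x mem' => holds mem' x s`!%:R)) => [s|i x mem2 ik p2 hx|].
  - exact: holds_monotone.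
  - apply: (runs_arith f hx (holds_prefix p2 (hn _ ik))).
    by rewrite /= -natrM factS mulnC.
  - exact: holds_prefix h1.
move=> fct mem2 p2 hf; rewrite -[(_ * 6)%N]addn0.
have d2 i : (i <= d./2.*2)%N -> (i <= d)%N.
  by move/leq_trans; apply; rewrite -[X in (_ <= X)%N]odd_double_half leq_addl.
apply: (runs_bind (c1 := 0) (c2 := 0)
  (Q1 := fun wt mem' => forall s, (s < d./2)%N -> holds mem' (wt s) (even_weight F d./2 s.+1))).
  have hw s mem3 : s \in iota 0 d./2 -> prefix mem2 mem3 ->
      runs f (weight_prog num fct d./2 s.+1) mem3 6 0
        (fun x mem' => holds mem' x (even_weight F d./2 s.+1)).
    rewrite mem_iota => /andP[_ sd] p3; apply: runs_weight => //.
    - exact: holds_prefix (prefix_trans p1 (prefix_trans p2 p3)) h0.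
    - by move=> i /d2 /hn; exact: holds_prefix (prefix_trans p2 p3).
    - by move=> i /d2 /hf; exact: holds_prefix p3.
  apply: (runs_weaken (runs_map 0%N (fun s => @holds_monotone F _) hw)).
  - by rewrite size_iota.
  - by rewrite muln0.
  - by move=> wt mem3 _ H s sd; apply: H; rewrite mem_iota.
move=> wt mem3 p3 hw; apply: runs_ret; split=> //= s sd.
exact: holds_prefix (prefix_trans p2 p3) (hn _ sd).
Qed.

Lemma runs_points o (op : F -> F -> F) num pa p m mem :
  (forall x y, eval_binop o x y = Some (op x y)) -> (m <= d)%N ->
  (forall s, (s <= d)%N -> holds mem (num s) s%:R) ->
  (forall l, holds mem (pa l) (p l)) ->
  runs f (point_prog o num pa m) mem (m * n) 0
    (fun x mem' => forall s, (s < m)%N -> forall l, holds mem' (x s l) (op (p l) s.+1%:R)).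
Proof.
move=> hop md hn hp.
pose P s (y : 'I_n -> nat) mem' := forall l, holds mem' (y l) (op (p l) s.+1%:R).
have mP s : monotone (P s) by move=> y m1 m2 p12 H l; exact: holds_prefix (H l).
have hs s mem1 : s \in iota 0 m -> prefix mem mem1 ->
    runs f (tabulate 0%N (fun l => arith n o (pa l) (num s.+1))) mem1 n 0 (P s).
  rewrite mem_iota => /andP[_ sm] p1.
  have hl l mem2 : prefix mem1 mem2 -> runs f (arith n o (pa l) (num s.+1)) mem2 1 0
      (fun x mem' => holds mem' x (op (p l) s.+1%:R)).
    move=> p2; have p12 := prefix_trans p1 p2.
    exact: (runs_arith f (holds_prefix p12 (hp _))
                         (holds_prefix p12 (hn _ (leq_trans sm md))) (hop _ _)).
  have := runs_tabulate 0%N (fun l => @holds_monotone F _) hl.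
  by rewrite card_ord muln1 muln0.
apply: (runs_weaken (runs_map (fun=> 0%N) mP hs)).
- by rewrite size_iota.
- by rewrite muln0.
- by move=> x mem1 _ H s sm; apply: H; rewrite mem_iota.
Qed.

End SlicePrograms.

Section SliceCorrect.
Variables (F : numFieldType) (n e : nat).
Notation d := e.+2.
Variables (g : {mpoly F[n]}) (U : tensor F n d).
Hypothesis gU : symmetric_tensor_of g U.
Notation f := (fun a : 'I_n -> F => g.@[a]).
Implicit Types (mem : seq F).

Lemma runs_coef2 wt pa plus minus p a b mem :
  holds mem 0 0 ->
  (forall s, (s < d./2)%N -> holds mem (wt s) (even_weight F d./2 s.+1)) ->
  (forall l, holds mem (pa l) (p l)) ->
  (forall s, (s < d./2)%N -> forall l, holds mem (plus s l) (p l + s.+1%:R)) ->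
  (forall s, (s < d./2)%N -> forall l, holds mem (minus s l) (p l - s.+1%:R)) ->
  runs f (coef2_prog wt pa plus minus d./2 a b) mem (d./2 * 5) (1 + d./2 * 2)
    (fun x mem' => holds mem' x ((line_poly U p (pair_indicator F a b))`_2)).
Proof.
move=> h0 hw hp hplus hminus; have [sU fU] := gU.
have fext (u v : 'I_n -> F) : u =1 v -> g.@[u] = g.@[v] by move/meval_eq->.
set G := line_poly U p (pair_indicator F a b).
have GE x : G.[x] = g.@[fun l => p l + x * pair_indicator F a b l].
  by rewrite horner_line_poly -fU.
(* For odd [d] this uses the extra degree that [even_interpolation] allows. *)
have szG : (size G <= d./2.*2.+2)%N.
  rewrite (leq_trans (size_line_poly _ _ _)) // ltnS.
  exact: leq_double_half.
rewrite -(even_interpolation szG) -[(d./2 * 5)%N]add0n.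
apply: runs_bind; first exact: (runs_query fext hp).
move=> g0 mem1 p1 hg0.
have {hg0} hg0 : holds mem1 g0 G.[0].
  by rewrite GE; under meval_eq do rewrite mul0r addr0.
have hs (s : 'I_d./2) mem2 : prefix mem1 mem2 ->
   runs f (bind (query (shift_pair a b pa (plus s))) (fun gp =>
    bind (query (shift_pair a b pa (minus s))) (fun gm =>
    bind (arith n Add gp gm) (fun x =>
    bind (arith n Defs.Sub x g0) (fun y =>
    bind (arith n Defs.Sub y g0) (fun z => arith n Mul (wt s) z)))))) mem2 4 2
    (fun x mem' => holds mem' x (even_weight F d./2 s.+1 *
       (G.[s.+1%:R] + G.[- s.+1%:R] - 2 * G.[0]))).
  move=> p2; have p12 := prefix_trans p1 p2.
  apply: (runs_bind (q1 := 0) (q2 := 4) (c1 := 1) (c2 := 1)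
            (Q1 := fun x mem' => holds mem' x G.[s.+1%:R])).
    rewrite GE; apply: (runs_query fext) => l.
    rewrite /shift_pair /pair_indicator; case: ifP => _; rewrite ?mulr1 ?mulr0 ?addr0.
      exact: holds_prefix p12 (hplus _ (ltn_ord s) l).
    exact: holds_prefix p12 (hp l).
  move=> gp mem3 p3 hgp.
  apply: (runs_bind (q1 := 0) (q2 := 4) (c1 := 1) (c2 := 0)
            (Q1 := fun x mem' => holds mem' x G.[- s.+1%:R])).
    rewrite GE; apply: (runs_query fext) => l.
    rewrite /shift_pair /pair_indicator; case: ifP => _; rewrite ?mulr1 ?mulr0 ?addr0.
      exact: holds_prefix (prefix_trans p12 p3) (hminus _ (ltn_ord s) l).
    exact: holds_prefix (prefix_trans p12 p3) (hp l).
  move=> gm mem4 p4 hgm; apply: (runs_bind (q1 := 1) (q2 := 3) (c1 := 0) (c2 := 0)).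
    exact: (runs_arith _ (holds_prefix p4 hgp) hgm).
  move=> x mem5 p5 hx; apply: (runs_bind (q1 := 1) (q2 := 2) (c1 := 0) (c2 := 0)).
    apply: (runs_arith _ hx (holds_prefix _ hg0)) => //.
    exact: prefix_trans p2 (prefix_trans p3 (prefix_trans p4 p5)).
  move=> y mem6 p6 hy; apply: (runs_bind (q1 := 1) (q2 := 1) (c1 := 0) (c2 := 0)).
    apply: (runs_arith _ hy (holds_prefix _ hg0)) => //.
    exact: prefix_trans p2 (prefix_trans p3 (prefix_trans p4 (prefix_trans p5 p6))).
  move=> z mem7 p7 hz.
  have p57 := prefix_trans p5 (prefix_trans p6 p7).
  have pw := prefix_trans p12 (prefix_trans p3 (prefix_trans p4 p57)).
  apply: (runs_arith _ (holds_prefix pw (hw _ (ltn_ord s))) hz).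
  by congr (Some (_ * _)); ring.
apply: (runs_weaken (runs_sum (enum 'I_d./2) (holds_prefix p1 h0) hs)).
- by rewrite size_enum_ord.
- by rewrite size_enum_ord.
- by move=> x mem2 _; rewrite add0r big_enum.
Qed.

Lemma runs_hessian q p mem :
  mx_holds mem q (\matrix_(a, b) (line_poly U p (pair_indicator F a b))`_2) ->
  runs f (hessian_prog q) mem (n * n * 2) 0
    (fun H mem' => mx_holds mem' H ((d * d.-1)%:R *: second_order U p)).
Proof.
have [sU _] := gU; move=> hq; rewrite -[X in runs _ _ _ _ X](muln0 (n * n)).
have C2 : (d * d.-1)%:R = 'C(d, 2)%:R * 2 :> F.
  by rewrite -natrM -[2%N]/(2`!) bin_ffact ffactnS ffactn1.
have hqE a b : holds mem (q a b) ('C(d, 2)%:R *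
    \sum_i \sum_j second_order U p i j * (pair_indicator F a b i * pair_indicator F a b j)).
  by have := hq a b; rewrite mxE coef2_line_poly.
have hqd a : holds mem (q a a) ('C(d, 2)%:R * second_order U p a a).
  by have := hqE a a; rewrite quadratic_form_diag.
apply: runs_tabulate_mx => a b mem1 p1.
have -> : ((d * d.-1)%:R *: second_order U p) a b = 'C(d, 2)%:R * 2 * second_order U p a b.
  by rewrite [LHS]mxE C2.
have [<-|ab] := eqVneq a b.
  apply: (runs_weaken (q := 1) (c := 0)) => //; last by move=> x m2 _ hx; exact: hx.
  apply: (runs_arith _ (holds_prefix p1 (hqd a)) (holds_prefix p1 (hqd a))).
  by congr Some; ring.
apply: (runs_bind (q1 := 1) (q2 := 1) (c1 := 0) (c2 := 0)).
  exact: (runs_arith _ (holds_prefix p1 (hqE a b)) (holds_prefix p1 (hqd a))).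
move=> x mem2 p2 hx; have p12 := prefix_trans p1 p2.
apply: (runs_arith _ hx (holds_prefix p12 (hqd b))).
rewrite quadratic_form_pair //; last exact: second_order_sym.
by congr Some; ring.
Qed.

Lemma runs_slice num wt Ma pa k mem (M : 'M[F]_n) (T : tensor F n d) :
  symmetric_tensor_of (lin_subst M g) T ->
  setup_done d (num, wt) mem -> holds mem 0 0 ->
  mx_holds mem Ma M -> (forall l, pa l = Ma l k) ->
  runs f (slice_prog d num wt Ma pa) mem (slice_cost n d) (n * n * (1 + d./2 * 2))
    (fun x mem' => mx_holds mem' x (slice T k)).
Proof.
move=> hT [hn hw] h0 hM hpa; set p := fun l => M l k.
have hp l : holds mem (pa l) (p l) by rewrite hpa.
have dd : (d./2 <= d)%N by rewrite -[X in (_ <= X)%N]odd_double_half -addnn addnA leq_addl.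
rewrite (slice_lin_subst k gU hT) /slice_cost -[X in runs _ _ _ _ X]add0n.
apply: runs_bind; first exact: (runs_points _ (op := fun x y => x + y) _ dd hn hp).
move=> plus mem1 p1 hplus; rewrite -[X in runs _ _ _ _ X]add0n.
apply: runs_bind.
  apply: (runs_points _ (op := fun x y => x - y) _ dd) => // [s sd|l].
    exact: holds_prefix (hn _ sd).
  exact: holds_prefix (hp l).
move=> minus mem2 p2 hminus; have p12 := prefix_trans p1 p2.
rewrite -[X in runs _ _ _ _ X]addn0.
apply: (runs_bind (Q1 := fun q mem' =>
  mx_holds mem' q (\matrix_(a, b) (line_poly U p (pair_indicator F a b))`_2))).
  apply: runs_tabulate_mx => a b mem3 p3; rewrite mxE.
  have p13 := prefix_trans p12 p3.
  apply: runs_coef2.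
  - exact: holds_prefix h0.
  - by move=> s sd; exact: holds_prefix (hw _ sd).
  - by move=> l; exact: holds_prefix (hp l).
  - by move=> s sd l; exact: holds_prefix (prefix_trans p2 p3) (hplus _ sd l).
  - by move=> s sd l; exact: holds_prefix p3 (hminus _ sd l).
move=> q mem3 p3 hq; rewrite -[X in runs _ _ _ _ X](addn0 0).
apply: runs_bind; first exact: runs_hessian hq.
move=> H mem4 p4 hH; rewrite -[X in runs _ _ _ _ X](addn0 0).
have p14 := prefix_trans p12 (prefix_trans p3 p4).
apply: runs_bind.
  apply: (runs_mul _ (X := M^T) (holds_prefix p14 h0) _ hH).
  by move=> i j; rewrite mxE; exact: holds_prefix (hM j i).
move=> X mem5 p5 hX; rewrite -[X in runs _ _ _ _ X](addn0 0).
have p15 := prefix_trans p14 p5.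
apply: runs_bind.
  exact: (runs_mul _ (holds_prefix p15 h0) hX (mx_holds_monotone p15 hM)).
move=> Y mem6 p6 hY; rewrite -[X in runs _ _ _ _ X](addn0 0).
have p16 := prefix_trans p15 p6.
apply: (runs_bind (Q1 := fun c mem' => holds mem' c (d * d.-1)%:R)).
  have hd1 : (d.-1 <= d)%N by rewrite leq_pred.
  apply: (runs_arith _ (holds_prefix p16 (hn d (leqnn d))) (holds_prefix p16 (hn d.-1 hd1))).
  by rewrite natrM.
move=> c mem7 p7 hc; rewrite -[X in runs _ _ _ _ X](muln0 (n * n)).
apply: runs_tabulate_mx => i j mem8 p8.
apply: (runs_arith _ (holds_prefix (prefix_trans p7 p8) (hY i j)) (holds_prefix p8 hc)).
have d0 : (d * d.-1)%:R != 0 :> F by rewrite pnatr_eq0 muln_eq0.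
rewrite /= (negPf d0); congr Some.
by rewrite -scalemxAr -scalemxAl mxE mulrC mulKf.
Qed.

End SliceCorrect.

(** * Lower bounds for the cost terms *)

(** Large integers cannot be among the finitely many constants of a multiplication algorithm. *)
Lemma natr_notin_seq (F : numDomainType) (K : seq F) :
  exists N, forall k, (N <= k)%N -> k%:R \notin K.
Proof.
elim: K => [|x K [N HN]]; first by exists 0%N.
have [[k0 ->]|H] := boolp.EM (exists k : nat, x = k%:R).
  exists (maxn N k0.+1) => k; rewrite geq_max => /andP[Nk kk].
  by rewrite inE negb_or HN // eqr_nat gtn_eqF.
exists N => k Nk; rewrite inE negb_or HN // andbT.
by apply/eqP => e; apply: H; exists k.
Qed.

(* All entries of T%:M *m B are new values, so each needs a memory cell of its
   own, created by an arithmetic operation. *)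
Lemma matrix_mul_ops_ge (F : numFieldType) n (K : seq F)
    (P : tree 0 ('I_n -> 'I_n -> nat)) : (0 < n)%N -> plain P ->
  exists A B : 'M[F]_n, forall o : outcome F ('I_n -> 'I_n -> nat),
    run (fun=> 0) (fun=> 0) (K ++ entries A ++ entries B) P = Some o ->
    read_mx (memory o) (answer o) = A *m B -> (n * n <= ops o)%N.
Proof.
move=> n0 pP; have [N0 HN0] := natr_notin_seq K.
(* From [N] on no integer is a constant, and the entries of B, at most n^2 + 1, lie below [N]. These
   entries start at 2, so that each product exceeds [N], the diagonal entry of A. *)
pose N := maxn N0 (n * n).+2.
have nN : ((n * n).+1 < N)%N by rewrite leq_max leqnn orbT.
have N_gt0 : (0 < N)%N by apply: leq_ltn_trans nN.
exists N%:R%:M, (\matrix_(i, j) (i * n + j).+2%:R) => o ro AB.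
have ABE i j : (memory o)`_(answer o i j) = (N * (i * n + j).+2)%:R.
  by move/matrixP/(_ i j): AB; rewrite mul_scalar_mx !mxE natrM.
have [e me se] := plain_run_memory pP ro.
have ij (i j : 'I_n) : (i * n + j < n * n)%N.
  by rewrite (leq_trans (_ : _ < i * n + n)%N) ?ltn_add2l // -mulSnr leq_mul2r ltn_ord orbT.
apply: leq_trans se.
rewrite -[X in (X <= _)%N](size_iota 0) -(size_map (fun k => (N * k.+2)%:R : F)).
apply: uniq_leq_size.
  rewrite map_inj_uniq ?iota_uniq // => a b /eqP.
  by rewrite eqr_nat eqn_pmul2l // => /eqP[].
move=> _ /mapP[k + ->]; rewrite mem_iota add0n => /= kn.
have jn : (k %% n < n)%N by rewrite ltn_mod.
have in_ : (k %/ n < n)%N by rewrite ltn_divLR.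
have := ABE (Ordinal in_) (Ordinal jn); rewrite /= -divn_eq => <-.
set x := answer o _ _.
(* An address beyond the memory would read 0, while all the entries of the product are positive. *)
have xs : (x < size (memory o))%N.
  rewrite ltnNge; apply/negP => /(nth_default 0); rewrite ABE /= -divn_eq => /eqP.
  by rewrite pnatr_eq0 muln_eq0 gtn_eqF.
have := mem_nth 0 xs; rewrite {2}me !mem_cat ABE /= -divn_eq.
have Nk : (N < N * k.+2)%N by rewrite -[X in (X < _)%N]muln1 ltn_pmul2l.
case/orP=> [|//]; case/or3P.
- apply: contraTT => _; apply: HN0; rewrite (leq_trans _ (ltnW Nk)) //.
  by rewrite leq_max leqnn.
- move=> /allpairsP[[i j] [_ _ /=]]; rewrite mxE => /eqP.
  case: (i == j); first by rewrite mulr1n eqr_nat gtn_eqF.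
  by rewrite /= pnatr_eq0 muln_eq0 gtn_eqF.
- move=> /allpairsP[[i j] [_ _ /=]]; rewrite mxE => /eqP.
  rewrite eqr_nat gtn_eqF // (leq_trans _ (ltnW Nk)) // (leq_trans _ nN) //.
  by rewrite !ltnS.
Qed.

Section Logarithms.
Variable R : realType.
Implicit Types x y : R.

Let ln2_gt0 : 0 < ln 2 :> R. Proof. by rewrite ln_gt0 // ltr1n. Qed.

Lemma log2_le x y : 0 < x -> x <= y -> log2 x <= log2 y.
Proof.
move=> x0 xy; rewrite /log2 ler_pM2r ?invr_gt0 // ler_ln ?posrE //.
exact: lt_le_trans xy.
Qed.

Lemma log2_gt0 x : 1 < x -> 0 < log2 x.
Proof. by move=> x1; rewrite divr_gt0 // ln_gt0. Qed.

Lemma log2_2 : log2 2 = 1 :> R.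
Proof. by rewrite /log2 divff // gt_eqF. Qed.

Lemma log2_1 : log2 1 = 0 :> R.
Proof. by rewrite /log2 ln1 mul0r. Qed.

Lemma log2_3_gt1 : 1 < log2 3 :> R.
Proof. by rewrite /log2 ltr_pdivlMr // mul1r ltr_ln ?posrE // ltr_nat. Qed.

(** The iterated logarithm is 0 at d = 2 and positive from d = 3 on; its value at 3 is a uniform
    lower bound for the factor. *)
Lemma log_factor_ge (d : nat) : (3 <= d)%N ->
  log2 (log2 3) <= log2 d%:R ^+ 2 * log2 (log2 d%:R) :> R.
Proof.
move=> d3.
have h : log2 3 <= log2 d%:R :> R by apply: log2_le; rewrite ?ler_nat.
have h1 : 1 <= log2 d%:R :> R by apply: le_trans h; exact: ltW log2_3_gt1.
have h2 : log2 (log2 3) <= log2 (log2 d%:R) :> R.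
  by apply: log2_le => //; exact: lt_trans ltr01 log2_3_gt1.
have h3 : 0 < log2 (log2 3) :> R := log2_gt0 log2_3_gt1.
rewrite (le_trans h2) // ler_peMl ?exprn_ege1 //.
by rewrite (le_trans _ h2) // ltW.
Qed.

End Logarithms.

(** * The algorithm *)

Section MainProgram.
Variables (n d : nat) (base : nat) (K : seq nat).
Variable P : tree 0 ('I_n -> 'I_n -> nat).

Definition draw_at (l j : nat) : nat := (base + (l * n + j))%N.

(** The identity block is made of addresses of the constant cells 0 and 1, at no cost. *)
Definition augment_at (a : 'I_n -> 'I_n -> nat) (i : 'I_n) (l : 'I_(n + n)) : nat :=
  match split l with inl j => a i j | inr j => if i == j then 1%N else 0%N end.

Definition decide_prog (sl : 'I_3 -> 'I_n -> 'I_n -> nat) : prog n (verdict n) :=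
  bind (gauss_prog (augment_at (sl (inord 0)))) (fun s =>
  if s.1 is Some _ then ret n (Verdict sl (fun _ _ => 0%N) false) else
  let inv i j := s.2 i (rshift n j) in
  bind (mul_prog n inv (sl (inord 1))) (fun a =>
  bind (mul_prog n inv (sl (inord 2))) (fun b =>
  bind (mul_prog n a b) (fun ab =>
  bind (mul_prog n b a) (fun ba =>
  bind (eq_mx_prog n ab ba) (fun comm =>
  bind (if comm then diag_prog K P a else ret n false) (fun acc =>
  ret n (Verdict sl inv acc)))))))).

Definition decide_cost (mu : nat) : nat :=
  (n * (n + ((n + n) + n * (n + n) * 2))
   + (n * n * (n * 2) + (n * n * (n * 2) + (n * n * (n * 2) + (n * n * (n * 2)
   + (n * n + (diag_cost n mu + 0)))))))%N.

Definition main_prog : prog n (verdict n) :=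
  bind (setup_prog n d) (fun x =>
  bind (tabulate (fun _ _ => 0%N) (fun k : 'I_3 =>
          slice_prog d x.1 x.2 (fun i j => draw_at i j) (fun l => draw_at l k)))
    decide_prog).

Definition main_cost (mu : nat) : nat :=
  (d * 1 + (d * 1 + d./2 * 6) + (3 * slice_cost n d + decide_cost mu))%N.

(** All draws come first and fill the cells from [base] on with the random matrix; the remaining
    program is draw-free, as [runs] demands. *)
Definition main_tree : tree n (verdict n) :=
  iter (n ^ 2)%N (@Draw n (verdict n))
    (tbind (main_prog (base + n ^ 2)%N) (fun x => Halt n x.1)).

End MainProgram.

Lemma run_draws (F : fieldType) n A (f : ('I_n -> F) -> F) (t : tree n A) k r mem :
  run f r mem (iter k (@Draw n A) t) =
  omap (fun o => Outcome (answer o) (memory o) (ops o) (calls o) (k + draws o)%N)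
    (run f (fun i => r (k + i)%N) (mem ++ mkseq r k) t).
Proof.
elim: k r mem => [|k IH] r mem /=.
  by rewrite cats0; case: (run _ _ _ _) => // -[].
rewrite IH cat_rcons; have -> : r 0%N :: mkseq (fun i => r i.+1) k = mkseq r k.+1.
  by rewrite /mkseq /= -[1%N]addn0 iotaDl -map_comp.
by case: (run _ _ _ _) => // -[].
Qed.

Lemma main_cost_le n d mu : (3 <= n)%N ->
  (main_cost n d mu <= 100 * (n ^ 2 * d + n ^ 3 + n * mu))%N.
Proof.
move=> n3; rewrite /main_cost /decide_cost /slice_cost /diag_cost.
have hd : (d./2.*2 <= d)%N by rewrite -[X in (_ <= X)%N]odd_double_half leq_addl.
rewrite -!muln2 in hd *; rewrite !expnS expn0.
move: (d./2) hd => h hd; nia.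
Qed.

Section Correctness.
Variables (C : numClosedFieldType) (m : nat).
Notation n := m.+1.
Variables (K : seq nat) (KF : seq C) (P : tree 0 ('I_n -> 'I_n -> nat)) (mu : nat).
Hypothesis plainP : plain P.
Hypothesis mulP : forall X Y : 'M[C]_n,
  exists o : outcome C ('I_n -> 'I_n -> nat),
    [/\ run (fun=> 0) (fun=> 0) (KF ++ entries X ++ entries Y) P = Some o,
        read_mx (memory o) (answer o) = X *m Y & (ops o <= mu)%N].
Variable f : ('I_n -> C) -> C.

Lemma mx_holds_read mem a (X : 'M[C]_n) : mx_holds mem a X -> read_mx mem a = X.
Proof. by move=> H; apply/matrixP => i j; rewrite mxE; case: (H i j). Qed.

Lemma runs_decide mem sl (T : 'I_3 -> 'M[C]_n) :
  all (fun x => x < size mem)%N K -> [seq mem`_x | x <- K] = KF ->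
  holds mem 0 0 -> holds mem 1 1 -> (forall k, mx_holds mem (sl k) (T k)) ->
  runs f (decide_prog K P sl) mem (decide_cost n mu) 0
    (fun v mem' => correct_verdict T mem' v).
Proof.
move=> szK valK h0 h1 hsl; rewrite /decide_cost -[X in runs _ _ _ _ X](addn0 0).
have hsl' mem' k : prefix mem mem' -> mx_holds mem' (sl k) (T k).
  by move=> p; exact: mx_holds_monotone p (hsl k).
set T1 := T (inord 0).
apply: runs_bind.
  apply: (runs_gauss f (X0 := row_mx T1 1%:M) h0) => i l.
  rewrite /augment_at mxE; case: split => j; first exact: hsl.
  by rewrite mxE; case: eqP.
move=> [st x] mem1 p1 /= [X res hx]; case: st res => [j|] res.
  apply: (runs_weaken (q := 0) (c := 0) (Q := fun v mem' =>
      v = Verdict sl (fun _ _ => 0%N) false /\ mem' = mem1)) => //.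
    exact: runs_ret.
  move=> _ _ _ [-> ->]; have /negPf nu := gauss_not_unit res.
  split=> //= [k|]; first by apply: mx_holds_read; exact: hsl'.
  by rewrite -/T1 nu.
have [Tu invT] := gauss_unit res.
set inv := fun i j => x i (rshift n j).
have hinv : mx_holds mem1 inv (invmx T1).
  by move=> i j; rewrite -invT mxE; exact: hx.
rewrite -[X in runs _ _ _ _ X](addn0 0); apply: runs_bind.
  exact: (runs_mul f (holds_prefix p1 h0) hinv (hsl' _ _ p1)).
move=> a mem2 p2 ha; rewrite -[X in runs _ _ _ _ X](addn0 0); apply: runs_bind.
  have p12 := prefix_trans p1 p2.
  exact: (runs_mul f (holds_prefix p12 h0) (mx_holds_monotone p2 hinv) (hsl' _ _ p12)).
move=> b mem3 p3 hb; rewrite -[X in runs _ _ _ _ X](addn0 0).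
have p13 := prefix_trans p1 (prefix_trans p2 p3).
apply: runs_bind.
  exact: (runs_mul f (holds_prefix p13 h0) (mx_holds_monotone p3 ha) hb).
move=> ab mem4 p4 hab; rewrite -[X in runs _ _ _ _ X](addn0 0).
have p34 := prefix_trans p3 p4; have p14 := prefix_trans p13 p4.
apply: runs_bind.
  exact: (runs_mul f (holds_prefix p14 h0) (mx_holds_monotone p4 hb) (mx_holds_monotone p34 ha)).
move=> ba mem5 p5 hba; rewrite -[X in runs _ _ _ _ X](addn0 0).
apply: runs_bind; first exact: (runs_eq_mx f (mx_holds_monotone p5 hab) hba).
move=> comm mem6 p6 ->; rewrite -[X in runs _ _ _ _ X](addn0 0).
have p16 := prefix_trans p14 (prefix_trans p5 p6).
have p26 := prefix_trans p34 (prefix_trans p5 p6).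
pose A := invmx T1 *m T (inord 1); pose B := invmx T1 *m T (inord 2).
apply: (runs_bind (Q1 := fun (acc : bool) _ => acc <-> comm_mx A B /\ diagonalizable A)).
  case: eqP => [AB|AB].
    apply: (runs_weaken (runs_diag f plainP mulP _ _ _ _ (mx_holds_monotone p26 ha))) => //.
    + apply: sub_all szK => y ys; rewrite (leq_trans ys) //.
      by have /prefixP[e ->] := p16; rewrite size_cat leq_addr.
    + rewrite -valK; apply/eq_in_map => y yK.
      by have /prefixP[e ->] := p16; rewrite nth_cat (allP szK).
    + exact: holds_prefix h0.
    + exact: holds_prefix h1.
    + by move=> acc mem7 _ ->; split=> [|[]].
  apply: (runs_weaken (q := 0) (c := 0) (Q := fun acc _ => acc = false)) => //.
    exact: runs_ret.
  by move=> _ _ _ ->; split=> // -[].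
move=> acc mem7 p7 hacc; apply: runs_ret; have p17 := prefix_trans p16 p7.
split=> /= [k||_]; first by apply: mx_holds_read; exact: hsl'.
  by rewrite -/T1 Tu.
split=> //; apply: mx_holds_read; apply: mx_holds_monotone hinv.
exact: prefix_trans p2 (prefix_trans p26 p7).
Qed.

End Correctness.

Lemma runs_main (C : numClosedFieldType) m e (K : seq nat) (KF : seq C)
    (P : tree 0 ('I_m.+1 -> 'I_m.+1 -> nat)) mu (g : {mpoly C[m.+1]})
    (M : 'M[C]_m.+1) (U T : tensor C m.+1 e.+2) base mem (hn : (3 <= m.+1)%N) :
  plain P ->
  (forall X Y : 'M[C]_m.+1, exists o : outcome C ('I_m.+1 -> 'I_m.+1 -> nat),
    [/\ run (fun=> 0) (fun=> 0) (KF ++ entries X ++ entries Y) P = Some o,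
        read_mx (memory o) (answer o) = X *m Y & (ops o <= mu)%N]) ->
  symmetric_tensor_of g U -> symmetric_tensor_of (lin_subst M g) T ->
  all (fun x => x < size mem)%N K -> [seq mem`_x | x <- K] = KF ->
  holds mem 0 0 -> holds mem 1 1 ->
  mx_holds mem (fun i j => draw_at m.+1 base i j) M ->
  runs (fun a => g.@[a]) (main_prog e.+2 base K P) mem (main_cost m.+1 e.+2 mu)
    (3 * (m.+1 * m.+1 * (1 + e.+2./2 * 2)))
    (fun v mem' => correct_verdict (fun k => slice T (widen_ord hn k)) mem' v).
Proof.
move=> plainP mulP gU hT szK valK h0 h1 hM; rewrite /main_cost -[X in runs _ _ _ _ X]add0n.
apply: runs_bind; first exact: runs_setup.
move=> [num wt] mem1 p1 hset; rewrite -[X in runs _ _ _ _ X]addn0.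
apply: (runs_bind (Q1 := fun sl mem' =>
  forall k, mx_holds mem' (sl k) (slice T (widen_ord hn k)))).
  have mP (k : 'I_3) : monotone (fun x mem' => mx_holds mem' x (slice T (widen_ord hn k))).
    exact: mx_holds_monotone.
  have hk (k : 'I_3) mem2 : prefix mem1 mem2 ->
      runs (fun a => g.@[a])
        (slice_prog e.+2 num wt (fun i j => draw_at m.+1 base i j)
           (fun l => draw_at m.+1 base l k)) mem2
        (slice_cost m.+1 e.+2) (m.+1 * m.+1 * (1 + e.+2./2 * 2))
        (fun x mem' => mx_holds mem' x (slice T (widen_ord hn k))).
    move=> p2; have p12 := prefix_trans p1 p2.
    apply: (runs_slice gU hT _ (holds_prefix p12 h0) (mx_holds_monotone p12 hM)) => //.
    case: hset => hnum hwt; split=> s sd.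
      exact: holds_prefix p2 (hnum s sd).
    exact: holds_prefix p2 (hwt s sd).
  by apply: (runs_weaken (runs_tabulate _ mP hk)); rewrite ?card_ord.
move=> sl mem2 p2 hsl; have p12 := prefix_trans p1 p2.
apply: (runs_decide plainP mulP _ _ _ _ _ hsl).
- apply: sub_all szK => y ys; rewrite (leq_trans ys) //.
  by have /prefixP[x ->] := p12; rewrite size_cat leq_addr.
- rewrite -valK; apply/eq_in_map => y yK.
  by have /prefixP[x ->] := p12; rewrite nth_cat (allP szK).
- exact: holds_prefix h0.
- exact: holds_prefix h1.
Qed.

Theorem theoremB1 (R : realType) (w : R) (hw : feasible_exponent w) :
  exists (K : seq R[i]) (c : R) (P : forall n d : nat, tree n (verdict n)),
  forall (n d : nat) (hn : (3 <= n)%N) (hd : (2 <= d)%N)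
    (f : {mpoly R[i][n]}) (hf : f \is d.-homog)
    (S : {fset R[i]}) (r : nat -> S),
  let r' := fun k => fsval (r k) in
  let h := lin_subst (drawn_mx n r') f in
  exists o : outcome R[i] (verdict n),
    [/\ run (fun a => f.@[a]) r' K (P n d) = Some o,
        draws o = (n ^ 2)%N,
        (calls o)%:R <= c * (n ^ 2 * d)%:R,
        (ops o)%:R <= c * ((n ^ 2 * d)%:R * log2 d%:R ^+ 2 * log2 (log2 d%:R)
                           + n%:R `^ (w + 1))
      & forall T : tensor R[i] n d, symmetric_tensor_of h T ->
          correct_verdict (fun k => slice T (widen_ord hn k)) (memory o)
            (answer o)].
Proof.
have [K0 [c [P hP]]] := hw.
(* The lower bound n^2 on the operations is confronted with the assumed upper bound; at n = 1 it
   also shows that [c] is at least 1. *)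
have n2_le n : (0 < n)%N -> (n ^ 2)%:R <= c * n%:R `^ w.
  move=> n0; have [pP mulP] := hP n n0.
  have [A [B /(_ _ _ _)]] := matrix_mul_ops_ge K0 n0 pP.
  have [o [ro AB co]] := mulP A B => /(_ o ro AB) le.
  by apply: le_trans co; rewrite ler_nat -mulnn.
have c_ge1 : 1 <= c by have := n2_le 1%N isT; rewrite exp1n powR1 mulr1.
(* Cells 0 and 1 hold the constants 0 and 1, so those of the multiplication start at address 2. *)
pose K := [:: 0, 1 & K0]; pose ka := iota 2 (size K0).
pose eps := log2 (log2 3) : R.
have eps_gt0 : 0 < eps := log2_gt0 (log2_3_gt1 R).
(* The term 6 is for the calls. For the operations, the factor 100 of [main_cost_le] multiplies n^2
   d, n^3 and n mu: the first is at most X / eps + cY, and the others are at most cY each. *)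
exists K, (100 / eps + 300 * c + 6), (fun n d => main_tree d (size K) ka (P n)).
move=> n d hn hd f hf S r r'.
case: n hn f hf => [//|m] hn f hf; case: d hd hf => [//|[//|e]] hd hf.
set n := m.+1 in hn f hf *; set d := e.+2 in hd hf *; move=> h.
have [pP mulP] := hP n isT.
(* Operation counts are natural numbers, so truncating the real bound loses nothing. *)
pose mu := Num.truncn (c * n%:R `^ w).
have cw_ge0 : 0 <= c * n%:R `^ w by rewrite mulr_ge0 ?powR_ge0 // (le_trans ler01).
have mulP' (X Y : 'M[R[i]]_n) : exists o : outcome R[i] ('I_n -> 'I_n -> nat),
    [/\ run (fun=> 0) (fun=> 0) (K0 ++ entries X ++ entries Y) (P n) = Some o,
        read_mx (memory o) (answer o) = X *m Y & (ops o <= mu)%N].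
  have [o [ro XY co]] := mulP X Y; exists o; split=> //.
  by rewrite /mu truncn_ge_nat.
have [U [hU _]] := symmetric_tensor_of_unique hf.
have [T [hT T_unique]] := symmetric_tensor_of_unique (lin_subst_homog (drawn_mx n r') hf).
pose mem := K ++ mkseq r' (n ^ 2)%N.
have hK x v : holds K x v -> holds mem x v by apply: holds_prefix; exact: prefix_prefix.
have szK : all (fun x => x < size mem)%N ka.
  apply/allP => x; rewrite mem_iota => /andP[_ xs].
  by rewrite size_cat ltn_addr.
have valK : [seq mem`_x | x <- ka] = K0.
  apply: (@eq_from_nth _ 0); rewrite size_map size_iota // => i iK.
  by rewrite (nth_map 0%N) ?size_iota // nth_iota // nth_cat /= ltnS ltnS iK.
have hM : mx_holds mem (fun i j => draw_at n (size K) i j) (drawn_mx n r').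
  move=> i j; rewrite /draw_at mxE.
  have ij : (i * n + j < n ^ 2)%N.
    rewrite -mulnn (leq_trans (_ : _ < i * n + n)%N) ?ltn_add2l //.
    by rewrite -mulSnr leq_mul2r ltn_ord orbT.
  split; first by rewrite size_cat ltn_add2l size_mkseq.
  by rewrite nth_cat ltnNge leq_addr /= addKn nth_mkseq.
have h0 : holds mem 0 0 by apply: hK.
have h1 : holds mem 1 1 by apply: hK.
have [v [ext [q [q' [hrun hq hq' hv]]]]] :=
  runs_main hn pP mulP' hU hT szK valK h0 h1 hM.
exists (Outcome v (mem ++ ext) q q' (n ^ 2)%N).
have d2 : (d./2.*2 <= d)%N by rewrite -[X in (_ <= X)%N]odd_double_half leq_addl.
have hc0 : 0 <= 100 / eps by rewrite divr_ge0 // ltW.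
split.
- rewrite /main_tree run_draws.
  have -> : (size K + n ^ 2)%N = size mem by rewrite size_cat size_mkseq.
  rewrite -/mem; set t := main_prog _ _ _ _ _.
  have E := run_tbind (fun x => Halt n x.1) (hrun (fun i => r' (n ^ 2 + i)%N)).
  by rewrite [X in omap _ X]E /= !addn0.
- by [].
- rewrite -[calls _]/q'.
  (* Three slices with n^2 coefficients each, and at most 1 + d <= 2d calls per coefficient. *)
  have le6 : (q' <= 6 * (n ^ 2 * d))%N.
    rewrite (leq_trans hq') // -mulnn; move: d2; rewrite -muln2.
    have : (0 < d)%N by [].
    by move: (d./2) (n * n)%N => d2 n2; nia.
  rewrite (le_trans (_ : _ <= 6 * (n ^ 2 * d)%:R)) ?ler_wpM2r ?ler0n //.
    by rewrite -natrM ler_nat.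
  by rewrite lerDr addr_ge0 // mulr_ge0 // (le_trans ler01).
- rewrite -[ops _]/q.
  have hq100 := leq_trans hq (main_cost_le d mu hn).
  have nw : n%:R `^ (w + 1) = n%:R `^ w * n%:R :> R.
    by rewrite powRD ?powRr1 // pnatr_eq0 implybT.
  have n3 : (n ^ 3)%:R <= c * n%:R `^ (w + 1).
    by rewrite nw mulrA expnSr natrM ler_wpM2r // n2_le.
  have nmu : (n * mu)%:R <= c * n%:R `^ (w + 1).
    by rewrite nw mulrA mulnC natrM ler_wpM2r // truncn_le.
  set Y := n%:R `^ (w + 1) in n3 nmu *.
  have Y0 : 0 <= Y := powR_ge0 _ _.
  set X := (n ^ 2 * d)%:R * log2 d%:R ^+ 2 * log2 (log2 d%:R).
  have [X0 hX] : 0 <= X /\ (n ^ 2 * d)%:R <= eps^-1 * X + c * Y.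
    (* At d = 2 the logarithmic term [X] is 0, and n^2 d is absorbed by n^3 because 2 <= n. *)
    have [d3|d3] := leqP 3 d; last first.
      have d2' : d = 2 by apply/eqP; rewrite eqn_leq -ltnS d3.
      have -> : X = 0 by rewrite /X d2' log2_2 log2_1 mulr0.
      rewrite lexx mulr0 add0r; split=> //; apply: le_trans n3.
      by rewrite ler_nat (expnSr n 2) leq_mul2l d2' (ltnW hn) orbT.
    have hl := log_factor_ge R d3; rewrite -/eps in hl.
    have XE : X = (n ^ 2 * d)%:R * (log2 d%:R ^+ 2 * log2 (log2 d%:R)) by rewrite /X mulrA.
    have X_ge : eps * (n ^ 2 * d)%:R <= X by rewrite XE mulrC ler_wpM2l.
    split; first by apply: le_trans X_ge; rewrite mulr_ge0 // ltW.
    rewrite (le_trans (_ : _ <= eps^-1 * X)) ?lerDl ?mulr_ge0 // ?(le_trans ler01) //.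
    by rewrite ler_pdivlMl.
  rewrite (le_trans (_ : _ <= 100 * ((n ^ 2 * d)%:R + (n ^ 3)%:R + (n * mu)%:R))) //.
    by rewrite -!natrD -natrM ler_nat.
  have cY : 0 <= c * Y by rewrite mulr_ge0 // (le_trans ler01).
  have eX : 0 <= eps^-1 * X by rewrite mulr_ge0 // invr_ge0 ltW.
  have eY : 0 <= eps^-1 * Y by rewrite mulr_ge0 // invr_ge0 ltW.
  have cX : 0 <= c * X by rewrite mulr_ge0 // (le_trans ler01).
  have -> : (100 / eps + 300 * c + 6) * (X + Y) =
    100 * (eps^-1 * X) + 100 * (eps^-1 * Y) + 300 * (c * X) + 300 * (c * Y) + 6 * X + 6 * Y.
    by ring.
  lra.
(* The run was analysed for one tensor of [h]; uniqueness of the symmetric tensor covers any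
   other. *)
by move=> T' hT'; rewrite -(T_unique T' hT').
Qed.
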